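(* Let $(q_m)_{m\ge 1}$ be the batch size distribution of an $M^{[X]}/M/1$ Processor-Sharing queue with batch arrival rate $\varrho>0$ and unit service rate, with $\mathbb{E}(B)=\sum_{m\ge1} m\,q_m<+\infty$ and $\varrho\,\mathbb{E}(B)<1$. For $n\ge 0$, $b\ge 1$ let $E_{n,b}(x)=\mathbb{P}(\Omega_{n,b}>x)$, $x\in\mathbb{R}^+$, where $\Omega_{n,b}$ is the sojourn time of a batch of size $b$ which finds $n$ jobs in the queue at its arrival. Then the functions $E_{n,b}$ verify the differential system $$ \frac{\mathrm{d}E_{n,b}}{\mathrm{d}x}(x)=\varrho\sum_{m\ge 1}q_m\,E_{n+m,b}(x)-(1+\varrho)E_{n,b}(x)+\frac{n}{n+b}E_{n-1,b}(x)+\frac{b}{n+b}E_{n,b-1}(x) $$ for all $x\in\mathbb{R}^+$, $n\ge 0$ and $b\ge 1$, where by convention $E_{n,b}=0$ if either $n<0$ or $b<1$.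
   Context: Queue: batches of jobs arrive according to a Poisson process of rate $\varrho$; batch sizes are i.i.d. with the law of $B$, $\mathbb{P}(B=m)=q_m$, $m\ge1$; the service requirements of all jobs are i.i.d. exponential with parameter $1$; arrivals, batch sizes and service requirements are independent. A single server of unit capacity serves all jobs present according to Processor Sharing: when $k\ge 1$ jobs are present, each is served at rate $1/k$. $\Omega_{n,b}$ denotes the sojourn time of a (tagged) batch given that it contains $b\ge1$ jobs and that $n\ge 0$ other jobs are already present in the queue at its arrival instant; it is the maximum of the sojourn times of the $b$ jobs composing the batch, i.e. the time from the arrival of the batch until all of its $b$ jobs are completed. *)

(* Defs.v *)
From HB Require Import structures.
From mathcomp Require Import all_boot all_order all_algebra.
From mathcomp Require Import all_classical all_reals all_analysis.

Set Implicit Arguments.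
Unset Strict Implicit.
Unset Printing Implicit Defensive.

Import Order.TTheory GRing.Theory Num.Theory.
Import numFieldNormedType.Exports.

Local Open Scope classical_set_scope.
Local Open Scope ring_scope.

Section independence.
Context d (T : measurableType d) (R : realType) (P : probability T R).

Definition mutually_independent (I : eqType) (F : I -> set (set T)) : Prop :=
  forall (s : seq I) (U : I -> set T), uniq s ->
    (forall i, i \in s -> F i (U i)) ->
    P (\bigcap_(i in [set` s]) U i) = (\prod_(i <- s) P (U i))%E.

Definition sigma_of d' (T' : measurableType d') (X : T -> T') : set (set T) :=
  [set X @^-1` V | V in measurable].

End independence.

Section batch_size.
Context (R : realType).

Definition batch_size_law (q : nat -> R) : Prop :=
  (forall m, (1 <= m)%N -> 0 <= q m) /\
  (\sum_(1 <= m <oo) (q m)%:E = 1)%E.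

Definition mean_batch_size (q : nat -> R) : \bar R :=
  (\sum_(1 <= m <oo) (m%:R * q m)%:E)%E.

End batch_size.

(* The tagged batch arrives at time 0.  [A 0] is the time from 0 to the next
   batch arrival and [A k], k >= 1, are the subsequent interarrival times: being
   i.i.d. exponential, they make the arrivals after 0 a Poisson process.  [B k]
   is the size of the k-th batch arriving after time 0.  [S j] is the service
   requirement of the j-th job, all jobs being numbered in a single sequence. *)
Record batch_queue_primitives d (T : measurableType d) (R : realType)
    (P : probability T R) (rho : R) (q : nat -> R)
    (A : nat -> {RV P >-> R}) (B : nat -> {RV P >-> nat})
    (S : nat -> {RV P >-> R}) : Prop := {
  interarrival_law : forall k (V : set R), measurable V ->
    P (A k @^-1` V) = exponential_prob rho V ;
  batch_law : forall k m, (1 <= m)%N -> P (B k @^-1` [set m]) = (q m)%:E ;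
  service_law : forall j (V : set R), measurable V ->
    P (S j @^-1` V) = exponential_prob 1 V ;
  primitives_independent : mutually_independent P
    (fun i : nat + nat + nat =>
       match i with
       | inl (inl k) => sigma_of (A k)
       | inl (inr k) => sigma_of (B k)
       | inr j => sigma_of (S j)
       end)
}.

Section processor_sharing.
Context (R : realType).

(* Sample paths of the queue, followed from one event (batch arrival or service
   completion) to the next.  A job is a pair (tagged?, remaining requirement). *)
Record queue_state := QueueState {
  clock : R ;
  next_arrival : R ;  (* time from [clock] to the next batch arrival *)
  batches : nat ;     (* batches arrived after time 0, up to [clock] *)
  drawn : nat ;       (* requirements of [S] already attributed to jobs *)
  jobs : seq (bool * R)
}.

Definition min_seq (s : seq R) : R := \big[Num.min/head 0 s]_(v <- s) v.

(* With k jobs present, each of them is served at rate 1 / k: serving during t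
   gives t / k to each, and the next completion, if no batch arrives before,
   takes k times the least remaining requirement. *)
Definition serve (t : R) (js : seq (bool * R)) : seq (bool * R) :=
  [seq (j.1, j.2 - t / (size js)%:R) | j <- js].

Definition completion_time (js : seq (bool * R)) : R :=
  (size js)%:R * min_seq (unzip2 js).

Definition in_service (js : seq (bool * R)) : seq (bool * R) :=
  [seq j <- js | 0 < j.2].

Definition holding_time (st : queue_state) : R :=
  if nilp (jobs st) then next_arrival st
  else Num.min (next_arrival st) (completion_time (jobs st)).

Definition new_jobs (tagged : bool) (S : nat -> R) (j m : nat) :
    seq (bool * R) :=
  [seq (tagged, S i) | i <- iota j m].

Definition ps_step (A : nat -> R) (B : nat -> nat) (S : nat -> R)
    (st : queue_state) : queue_state :=
  let t := holding_time st in
  let js := in_service (serve t (jobs st)) in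
  let k := batches st in
  if next_arrival st == t then
    QueueState (clock st + t) (A k.+1) k.+1 (drawn st + B k)
      (js ++ new_jobs false S (drawn st) (B k))
  else
    QueueState (clock st + t) (next_arrival st - t) k (drawn st) js.

(* The n jobs found by the tagged batch enter through the service they still
   require, again i.i.d. exponential with parameter 1 by lack of memory. *)
Definition ps_init (A S : nat -> R) (n b : nat) : queue_state :=
  QueueState 0 (A 0) 0 (b + n) (new_jobs true S 0 b ++ new_jobs false S b n).

Definition ps_state (A : nat -> R) (B : nat -> nat) (S : nat -> R) (n b : nat)
    (N : nat) : queue_state :=
  iter N (ps_step A B S) (ps_init A S n b).

Definition batch_completed (st : queue_state) : bool := ~~ has fst (jobs st).

(* First event time at which no tagged job is left; it is +oo if there is none *)
Definition batch_sojourn (A : nat -> R) (B : nat -> nat) (S : nat -> R)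
    (n b : nat) : \bar R :=
  ereal_inf [set (clock (ps_state A B S n b N))%:E
            | N in [set N | batch_completed (ps_state A B S n b N)]].

End processor_sharing.

Section sojourn_tail.
Context d (T : measurableType d) (R : realType) (P : probability T R).

Definition Omega (A : nat -> {RV P >-> R}) (B : nat -> {RV P >-> nat})
    (S : nat -> {RV P >-> R}) (n b : nat) : T -> \bar R :=
  fun w => batch_sojourn (fun k => A k w) (fun k => B k w) (fun j => S j w) n b.

(* E_{n,b}(x) for integer indices, with the convention for n < 0 or b < 1 *)
Definition sojourn_tail (A : nat -> {RV P >-> R}) (B : nat -> {RV P >-> nat})
    (S : nat -> {RV P >-> R}) (n b : int) (x : R) : R :=
  if (n < 0) || (b < 1) then 0
  else fine (P [set w | (x%:E < Omega A B S `|n|%N `|b|%N w)%E]).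

End sojourn_tail.

(* Derivative at x of a function on [0, +oo[: two-sided when x > 0, right
   derivative when x = 0; values of f on ]-oo, 0[ are irrelevant. *)
Definition has_derivative_nonneg (R : realType) (f : R -> R) (x l : R) : Prop :=
  (f y - f x) / (y - x) @[y --> within `[0, +oo[ x^'] --> l.

(* Main.v *)
(* Compare E_{n,b}(x + h) with E_{n,b}(x) by looking at the first event (batch
   arrival or service completion) after time 0.  Up to a set of probability
   O(h^2), either nothing happens before h, or one of the k = n + b jobs completes
   first, or a batch of size m arrives first; these have probabilities
   exp(-(1 + rho) h), h / k + O(h^2) and rho q_m h + O(h^2).  In each case the
   residual clocks, suitably renumbered, are independent of the event and of the
   elapsed time t and again distributed as the primitives of the queue, so the
   conditional probability of outliving x + h lies between E_{n',b'}(x + h) and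
   E_{n',b'}(x) for the new state (n', b').  As E is Lipschitz with constant
   1 + rho, uniformly in (n, b), this gives
     |E_{n,b}(x + h) - E_{n,b}(x) - h D_{n,b}(x)| <= 3 (1 + rho)^2 h^2,
   D being the right-hand side of the system, and D is itself Lipschitz, whence
   the derivative on both sides of x.
   The residual law is first computed on cylinders of half-lines and then extended
   to the generated sigma-algebra by Dynkin's theorem. *)
Require Import Defs.
From HB Require Import structures.
From mathcomp Require Import all_boot all_order all_algebra.
From mathcomp Require Import all_classical all_reals all_analysis.
From mathcomp Require Import measurable_realfun ring lra zify.

Set Implicit Arguments.
Unset Strict Implicit.
Unset Printing Implicit Defensive.

Import Order.TTheory GRing.Theory Num.Theory.
Import numFieldNormedType.Exports.

Local Open Scope classical_set_scope.
Local Open Scope ring_scope.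

(** The obstacle is that the elapsed time at a completion or an arrival is itself random, while the
    hypotheses give independence only as a product formula over finitely many sources. Instead of
    integrating over the law of the elapsed time, the window []0, h]] is cut into equal slices. On a
    slice the elapsed time is frozen at an endpoint, so that every event becomes a finite product;
    the factorisation then fails by at most a constant times the length of the slice times its mass.
    These defects add up to O(1/N) for N slices, so the factorisation is exact. An event records
    only what rings first and ignores the sequel: several events before [h] need no separate case,
    and the O(h^2) loss comes from lower bounds on probabilities. All bounds are uniform in (n, b)
    because K jobs, each served at speed 1/K, have total rate 1 whatever K is; with the arrivals the
    total is 1 + rho. The Lipschitz constant comes from the quiet event alone, E(y + h) >= P(quiet)
    E(y) with P(quiet) >= 1 - (1 + rho) h. *)

Section prob_fine.
Context d (T : measurableType d) (R : realType) (P : probability T R).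

Lemma prob_EFin (U : set T) : measurable U -> P U = (fine (P U))%:E.
Proof. by move=> mU; rewrite fineK// fin_num_measure. Qed.

Lemma prob_fine_ge0 (U : set T) : 0 <= fine (P U).
Proof. by rewrite fine_ge0. Qed.

Lemma prob_fine_le (U V : set T) : measurable U -> measurable V ->
  U `<=` V -> fine (P U) <= fine (P V).
Proof.
move=> mU mV UV; rewrite -lee_fin -!prob_EFin//.
by apply: le_measure => //; rewrite inE.
Qed.

Lemma prob_fine_le1 (U : set T) : measurable U -> fine (P U) <= 1.
Proof. by move=> mU; rewrite -lee_fin -prob_EFin// probability_le1. Qed.

Lemma prob_fineU (U V : set T) : measurable U -> measurable V ->
  U `&` V = set0 -> fine (P (U `|` V)) = fine (P U) + fine (P V).
Proof. by move=> mU mV UV; rewrite measureU// fineD// fin_num_measure. Qed.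

End prob_fine.

(** * Half-lines and the pi-system of their cylinders *)

Section rays.
Context (R : realType).

(** Half-lines generate the Borel sets and have explicit exponential probabilities. [setT] is
    included so that a cylinder can be rewritten over a larger set of coordinates, as in
    [cylinderS]. *)
Definition ray : set (set R) :=
  [set V | V = setT \/ exists a, V = `]a, +oo[%classic].

Lemma measurable_ray (V : set R) : ray V -> measurable V.
Proof. by case=> [->|[a ->]]; [exact: measurableT|exact: measurable_itv]. Qed.

Lemma rayI : setI_closed ray.
Proof.
move=> _ _ [->|[a ->]] [->|[b ->]]; rewrite ?setTI ?setIT.
- by left.
- by right; exists b.
- by right; exists a.
- right; exists (Num.max a b); apply/seteqP; split => x /=; rewrite !in_itv /= !andbT gt_max.
    by case=> -> ->.
  by move=> /andP[].
Qed.

Lemma rayT : ray setT. Proof. by left. Qed.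

Lemma ray_gt (a : R) : ray [set x | a < x].
Proof. by right; exists a; rewrite set_itvoy. Qed.

Context (I : eqType).

Definition cylinder (s : seq I) (V : I -> set R) : set (I -> R) :=
  [set f | forall i, i \in s -> V i (f i)].

Definition ray_cylinders : set (set (I -> R)) :=
  [set C | exists s V, [/\ uniq s, forall i, ray (V i) & C = cylinder s V]].

Lemma cylinderS (s s' : seq I) (V : I -> set R) : {subset s <= s'} ->
  cylinder s V = cylinder s' (fun i => if i \in s then V i else setT).
Proof.
move=> ss'; apply/seteqP; split=> f Hf i.
  by move=> _; case: ifP => // /Hf.
by move=> si; have := Hf i (ss' i si); rewrite si.
Qed.

Lemma ray_cylindersI : setI_closed ray_cylinders.
Proof.
move=> _ _ [s [V [us rV ->]]] [s' [V' [us' rV' ->]]].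
exists (undup (s ++ s')).
exists (fun i => (if i \in s then V i else setT) `&`
                 (if i \in s' then V' i else setT)).
split; first exact: undup_uniq.
  by move=> i; apply: rayI; case: ifP => _ //; exact: rayT.
rewrite (@cylinderS s (undup (s ++ s')));
  last by move=> i; rewrite mem_undup mem_cat => ->.
rewrite (@cylinderS s' (undup (s ++ s')));
  last by move=> i; rewrite mem_undup mem_cat => ->; rewrite orbT.
apply/seteqP; split=> f.
  by case=> H1 H2 i si; split; [exact: H1|exact: H2].
by move=> H; split=> i /H[].
Qed.

End rays.

Lemma measurable_forall_seq d (T : measurableType d) (I : choiceType)
    (s : seq I) (F : I -> set T) : (forall i, i \in s -> measurable (F i)) ->
  measurable [set w | forall i, i \in s -> F i w].
Proof.
move=> mF; rewrite (_ : [set w | _] = \bigcap_(i in [set` s]) F i)//.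
exact: fin_bigcap_measurable.
Qed.

(** Summing the bound over N + 1 equal steps gives [K * (h / N.+1%:R) * m 0 h], and N is arbitrary.
    In the application [f] is the defect of a product formula on a window and [m] the probability of
    that window. *)
Lemma eq0_of_small_increments (R : realType) (f m : R -> R -> R) (K h : R) :
    0 <= h -> 0 <= K ->
    (forall a b c, a <= b -> b <= c -> f a c = f a b + f b c) ->
    (forall a b c, a <= b -> b <= c -> m a c = m a b + m b c) ->
    (forall a b, 0 <= a -> a <= b -> 0 <= m a b) ->
    (forall a b, 0 <= a -> a <= b -> `|f a b| <= K * (b - a) * m a b) ->
  f 0 h = 0.
Proof.
move=> h0 K0 fD mD m0 fm.
have grid (N : nat) : `|f 0 h| <= K * (h / N.+1%:R) * m 0 h.
  set e := h / N.+1%:R.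
  have e0 : 0 <= e by rewrite divr_ge0.
  have f00 : f 0 0 = 0 by have := fD 0 0 0 (lexx _) (lexx _); lra.
  have m00 : m 0 0 = 0 by have := mD 0 0 0 (lexx _) (lexx _); lra.
  have step (j : nat) : `|f 0 (j%:R * e)| <= K * e * m 0 (j%:R * e).
    elim: j => [|j IH]; first by rewrite mul0r f00 m00 mulr0 normr0.
    have je : j%:R * e <= j.+1%:R * e by rewrite ler_wpM2r// ler_nat.
    have j0 : 0 <= j%:R * e by rewrite mulr_ge0.
    rewrite (fD _ _ _ j0 je) (mD _ _ _ j0 je).
    apply: le_trans (ler_normD _ _) _; rewrite mulrDr; apply: lerD => //.
    have := fm _ _ j0 je.
    by rewrite (_ : j.+1%:R * e - j%:R * e = e)// -natr1; ring.
  by have := step N.+1; rewrite (_ : N.+1%:R * e = h)// mulrC divfK// pnatr_eq0.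
have B0 : 0 <= K * h * m 0 h by rewrite !mulr_ge0// m0.
apply/eqP; rewrite -normr_le0; apply/ler_addgt0Pr => e e0; rewrite add0r.
have [N NB] : exists N : nat, K * h * m 0 h / e < N%:R.
  by exists (Num.truncn (K * h * m 0 h / e)).+1; rewrite truncnS_gt.
apply: le_trans (grid N) _.
rewrite (_ : _ * _ * _ = K * h * m 0 h / N.+1%:R); last by rewrite mulrA mulrAC.
rewrite ler_pdivrMr// [leRHS]mulrC -ler_pdivrMr//; apply/ltW/(lt_trans NB).
by rewrite ltr_nat.
Qed.

Lemma measurable_lt_set d (T : measurableType d) (R : realType) (f g : T -> R) :
  measurable_fun setT f -> measurable_fun setT g ->
  measurable [set w | f w < g w].
Proof.
move=> mf mg; rewrite -[X in measurable X]setTI.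
exact: (measurable_fun_ltr mf mg measurableT (_ : measurable [set true])).
Qed.

(** * Memorylessness at a random time *)

(* At the time [tau], on the event [Q], the exponential clock [X (pi i)], [i \in L],
   which has rate [r i] and has been running at speed [c i], is still alive with
   residual life [X (pi i) - c i * tau].  The map [pi] renumbers the sources that
   are left after [tau].  The residual family is independent of the
   event that has just occurred and distributed as [X]. *)
Section race.
Context d (T : measurableType d) (R : realType) (P : probability T R).
Context (I : choiceType) (X : I -> T -> R) (pi : I -> I) (L : seq I).
Context (c r : I -> R) (Q : set T) (tau : T -> R).
Hypothesis mX : forall i, measurable_fun setT (X i).
Hypothesis mQ : measurable Q.
Hypothesis mtau : measurable_fun setT tau.
Hypothesis c_ge0 : forall i, i \in L -> 0 <= c i.
Hypothesis r_ge0 : forall i, i \in L -> 0 <= r i.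
Hypothesis uniqL : uniq L.
Hypothesis exp_tail : forall i (a : R), i \in L -> 0 <= a ->
  fine (P [set w | a < X (pi i) w]) = expR (- (r i * a)).
Hypothesis law_pi : forall i V, ray V ->
  P (X (pi i) @^-1` V) = P (X i @^-1` V).
Hypothesis indep : forall (s : seq I) (V : I -> set R), uniq s ->
  (forall i, ray (V i)) ->
  fine (P [set w | forall i, i \in s -> V i (X i w)]) =
  \prod_(i <- s) fine (P (X i @^-1` V i)).

Definition window (a b : R) : set T := [set w | Q w /\ a < tau w <= b].

Hypothesis indep_window : forall a b (s : seq I) (V : I -> set R),
  a <= b -> uniq s -> (forall i, ray (V i)) ->
  fine (P (window a b `&` [set w | forall i, i \in s -> V i (X (pi i) w)])) =
  fine (P (window a b)) * \prod_(i <- s) fine (P (X (pi i) @^-1` V i)).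

Definition residual (w : T) (i : I) : R :=
  X (pi i) w - (if i \in L then c i * tau w else 0).

(** The affected clocks have to be alive at [tau], not at [h]: whatever happens between [tau] and
    [h] is left free. *)
Definition race_won (h : R) : set T :=
  window 0 h `&` [set w | forall i, i \in L -> c i * tau w < X (pi i) w].

(** The rate at which the probability that all the affected clocks are alive decays with the elapsed
    time. *)
Let kappa := \sum_(i <- L) r i * c i.

Lemma measurable_window a b : measurable (window a b).
Proof.
rewrite (_ : window a b = Q `&` tau @^-1` `]a, b]%classic); last first.
  by apply/seteqP; split=> w /=; rewrite in_itv.
apply: measurableI => //.
by rewrite -[X in measurable X]setTI; apply: mtau => //; exact: measurable_itv.
Qed.

Lemma windowU a b e : a <= b -> b <= e ->
  window a e = window a b `|` window b e.
Proof.
move=> ab be; apply/seteqP; split=> w /=.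
  move=> [Qw /andP[h1 h2]]; have [h3|h3] := leP (tau w) b; [left|right]; split=> //.
    by rewrite h1 h3.
  by rewrite h2 h3.
case=> -[Qw /andP[h1 h2]]; split=> //.
  by rewrite h1 (le_trans h2).
by rewrite h2 (le_lt_trans ab).
Qed.

Lemma windowI a b e : window a b `&` window b e = set0.
Proof.
apply/seteqP; split=> w //= [[_ /andP[_ h1]] [_ /andP[h2 _]]].
by rewrite ltNge h1 in h2.
Qed.

Lemma measurable_pre (i : I) (V : set R) : measurable V ->
  measurable (X i @^-1` V).
Proof. by move=> mV; rewrite -[X in measurable X]setTI; exact: mX. Qed.

(** The constraints of [ahead] with the random time frozen at [a]. *)
Let box (v : I -> R) (V : I -> set R) (a : R) (i : I) : set R :=
  if i \in L then [set x | c i * a + v i < x] else V i.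

(** The probability of the same constraints for fresh clocks, that is the value expected from
    memorylessness. *)
Let W (s : seq I) (v : I -> R) (V : I -> set R) :=
  (\prod_(i <- L) expR (- (r i * v i))) *
  (\prod_(i <- s) fine (P (X (pi i) @^-1` V i))).

Let ahead (s : seq I) (v : I -> R) (V : I -> set R) : set T :=
  [set w | forall i, i \in L -> c i * tau w + v i < X (pi i) w] `&`
  [set w | forall i, i \in s -> V i (X (pi i) w)].

Let measurable_ahead s v V : (forall i, ray (V i)) -> measurable (ahead s v V).
Proof.
move=> rV; apply: measurableI; apply: measurable_forall_seq => i _.
  apply: measurable_lt_set => //.
  by apply: measurable_funD => //; exact: measurable_funM.
by apply: measurable_pre; exact: measurable_ray.
Qed.

Let ray_box v V a i : (forall i, ray (V i)) -> ray (box v V a i).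
Proof. by move=> rV; rewrite /box; case: ifP => _ //; exact: ray_gt. Qed.

Let box_prob s (v : I -> R) V (a b e : R) : 0 <= a -> b <= e -> uniq (L ++ s) ->
  (forall i, ray (V i)) -> (forall i, i \in L -> 0 <= v i) ->
  fine (P (window b e `&`
     [set w | forall i, i \in L ++ s -> box v V a i (X (pi i) w)])) =
  fine (P (window b e)) * (expR (- (kappa * a)) * W s v V).
Proof.
move=> a0 be us rV v0; rewrite indep_window//; last by move=> i; exact: ray_box.
congr (_ * _); rewrite big_cat/= /W mulrA; congr (_ * _).
  rewrite (_ : expR _ = \prod_(i <- L) expR (- (r i * c i * a))); last first.
    by rewrite -expR_sum; congr expR; rewrite sumrN -mulr_suml.
  rewrite -big_split/=; apply: eq_big_seq => i iL.
  rewrite /box iL (_ : X (pi i) @^-1` _ = [set w | c i * a + v i < X (pi i) w])//.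
  rewrite exp_tail//; last by rewrite addr_ge0 ?v0// mulr_ge0 ?c_ge0.
  by rewrite -expRD; congr expR; ring.
apply: eq_big_seq => i si; rewrite /box ifN//.
by move: us; rewrite cat_uniq => /and3P[_ /hasPn/(_ _ si)].
Qed.

Let measurable_box s v V a : (forall i, ray (V i)) ->
  measurable [set w | forall i, i \in L ++ s -> box v V a i (X (pi i) w)].
Proof.
move=> rV; apply: measurable_forall_seq => i _.
by apply: measurable_pre; apply: measurable_ray; exact: ray_box.
Qed.

(* On a window [a < tau <= b] replacing [tau] by [a] or by [b] makes the event a
   product event; the two bounds differ by O(b - a) times the mass of the window. *)
Let ahead_bounds s (v : I -> R) V (a b : R) : 0 <= a -> a <= b -> uniq (L ++ s) ->
  (forall i, ray (V i)) -> (forall i, i \in L -> 0 <= v i) ->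
  fine (P (window a b)) * (expR (- (kappa * b)) * W s v V)
    <= fine (P (window a b `&` ahead s v V)) <=
  fine (P (window a b)) * (expR (- (kappa * a)) * W s v V).
Proof.
move=> a0 ab us rV v0; rewrite -!(box_prob _ ab)// ?(le_trans a0)//.
have mw := measurable_window a b.
have ma := @measurable_ahead s v V rV.
have mb e : measurable (window a b `&`
    [set w | forall i, i \in L ++ s -> box v V e i (X (pi i) w)]).
  by apply: measurableI => //; exact: measurable_box.
have mwa := measurableI _ _ mw ma.
apply/andP; split; apply: prob_fine_le => //.
- move=> w [ww H]; split=> //; case: ww => Qw /andP[h1 h2]; split=> i iL.
    have := H i; rewrite mem_cat /box iL => /(_ isT) /=; apply: le_lt_trans.
    by rewrite lerD2r ler_wpM2l ?c_ge0.
  have := H i; rewrite mem_cat iL orbT /box => /(_ isT); rewrite ifN//.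
  by move: us; rewrite cat_uniq => /and3P[_ /hasPn/(_ _ iL)].
- move=> w [ww [H1 H2]]; split=> // i iL; rewrite /box.
  case: ww => Qw /andP[h1 h2].
  case: ifPn => [iL'|iL'] /=.
    apply: le_lt_trans (H1 i iL'); rewrite lerD2r ler_wpM2l ?c_ge0//.
    exact: ltW.
  by apply: H2; move: iL; rewrite mem_cat (negbTE iL').
Qed.

Let prob_aheadU s v V a b e : (forall i, ray (V i)) -> a <= b -> b <= e ->
  fine (P (window a e `&` ahead s v V)) =
  fine (P (window a b `&` ahead s v V)) + fine (P (window b e `&` ahead s v V)).
Proof.
move=> rV ab be; rewrite (windowU ab be) setIUl prob_fineU//.
- by apply: measurableI; [exact: measurable_window|exact: measurable_ahead].
- by apply: measurableI; [exact: measurable_window|exact: measurable_ahead].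
by rewrite setIACA windowI set0I.
Qed.

Let W_ge0 s v V : 0 <= W s v V.
Proof.
by apply: mulr_ge0; apply: prodr_ge0 => i _; rewrite ?expR_ge0// prob_fine_ge0.
Qed.

Let kappa_ge0 : 0 <= kappa.
Proof.
rewrite /kappa big_seq; apply: sumr_ge0 => i iL.
by rewrite mulr_ge0 ?r_ge0 ?c_ge0.
Qed.

Let race_wonE h : race_won h = window 0 h `&` ahead [::] (fun=> 0) (fun=> setT).
Proof.
apply/seteqP; split=> w [H1 H2]; split=> //.
  by split=> // i iL; rewrite addr0; exact: H2.
by move=> i iL; case: H2 => /(_ i iL); rewrite addr0.
Qed.

Let W0 : W [::] (fun=> 0) (fun=> setT) = 1.
Proof.
by rewrite /W big_nil mulr1 big1// => i _; rewrite mulr0 oppr0 expR0.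
Qed.

Lemma race_won_bounds (h : R) : 0 <= h ->
  fine (P (window 0 h)) * expR (- (kappa * h)) <= fine (P (race_won h))
  <= fine (P (window 0 h)).
Proof.
move=> h0; rewrite race_wonE.
have := @ahead_bounds [::] (fun=> 0) (fun=> setT) 0 h (lexx _) h0.
rewrite cats0 W0 !mulr1 mulr0 oppr0 expR0 mulr1; apply=> //.
by move=> i; exact: rayT.
Qed.

(** On a window both terms of the defect lie between the two bounds of [ahead_bounds]. Since
    exp(-kappa a) - exp(-kappa b) <= kappa (b - a), the defect is at most W kappa (b - a) times the
    mass of the window, and [eq0_of_small_increments] makes it vanish. *)
Let ahead_factor s (v : I -> R) V (h : R) : 0 <= h -> uniq (L ++ s) ->
  (forall i, ray (V i)) -> (forall i, i \in L -> 0 <= v i) ->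
  fine (P (window 0 h `&` ahead s v V)) = W s v V * fine (P (race_won h)).
Proof.
move=> h0 us rV v0; rewrite race_wonE.
set A0 := ahead [::] _ _.
apply/eqP; rewrite -subr_eq0; apply/eqP.
have rT : forall i : I, ray (setT : set R) by move=> i; exact: rayT.
apply: (@eq0_of_small_increments R
  (fun a b => fine (P (window a b `&` ahead s v V)) -
              W s v V * fine (P (window a b `&` A0)))
  (fun a b => fine (P (window a b))) (W s v V * kappa)) => //.
- by rewrite mulr_ge0.
- move=> a b e ab be; rewrite /A0 !(prob_aheadU _ _ _ ab be)//; ring.
- move=> a b e ab be; rewrite (windowU ab be) prob_fineU ?windowI//;
    exact: measurable_window.
- by move=> a b _ _; exact: prob_fine_ge0.
move=> a b a0 ab.
have := ahead_bounds a0 ab us rV v0.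
have := @ahead_bounds [::] (fun=> 0) (fun=> setT) a b a0 ab.
rewrite cats0 -/A0 W0 !mulr1 => /(_ uniqL rT (fun _ _ => lexx _)).
have ka : expR (- (kappa * a)) <= 1 by rewrite -expR0 ler_expR; rewrite oppr_le0 mulr_ge0.
have kb : expR (- (kappa * a)) - expR (- (kappa * b)) <= kappa * (b - a).
  rewrite (_ : - (kappa * b) = - (kappa * a) + - (kappa * (b - a))); last by ring.
  rewrite expRD -{1}[expR (- (kappa * a))]mulr1 -mulrBr.
  have := expR_ge1Dx (- (kappa * (b - a))).
  have : 0 <= kappa * (b - a) by rewrite mulr_ge0// subr_ge0.
  have := expR_ge0 (- (kappa * a)); nra.
move: (fine (P (window a b `&` ahead s v V))) (fine (P (window a b `&` A0))) => x y.
have := @prob_fine_ge0 _ _ _ P (window a b).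
move: (fine (P (window a b))) (expR _) (expR _) ka kb (W_ge0 s v V) => m eb ea.
move: (W s v V) => w ea1 kb w0 m0 /andP[h1 h2] /andP[h3 h4].
have mw0 : 0 <= m * w by rewrite mulr_ge0.
have : m * w * (ea - eb) <= m * w * (kappa * (b - a)) by rewrite ler_wpM2l.
have : w * y <= w * (m * ea) by rewrite ler_wpM2l.
have : w * (m * eb) <= w * y by rewrite ler_wpM2l.
rewrite ler_norml; nra.
Qed.

(** Affected residuals are positive on [race_won] and exponential variables are positive almost
    surely, so only the trace of a half-line on the positive numbers matters. A negative endpoint or
    [setT] then becomes the threshold 0, within the range of [exp_tail]. *)
Let ray_threshold (V : set R) : ray V ->
  exists2 v : R, 0 <= v & forall x, 0 < x -> V x <-> v < x.
Proof.
case=> [->|[a ->]]; first by exists 0.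
exists (Num.max a 0); first by rewrite le_max lexx orbT.
by move=> x x0; rewrite /= in_itv/= andbT gt_max x0 andbT.
Qed.

Lemma measurable_race_won (h : R) : measurable (race_won h).
Proof.
by rewrite race_wonE; apply: measurableI;
  [exact: measurable_window|apply: measurable_ahead => i; exact: rayT].
Qed.

Lemma measurable_residual i : measurable_fun setT (residual ^~ i).
Proof.
rewrite /residual; apply: measurable_funB => //.
by case: (i \in L) => //; exact: measurable_funM.
Qed.

(** [V] may contain nonpositive points, but the clock exceeds 0 with probability 1, by [exp_tail] at
    0. *)
Let fine_prob_threshold i V v : i \in L -> ray V -> 0 <= v ->
  (forall x, 0 < x -> V x <-> v < x) ->
  fine (P (X (pi i) @^-1` V)) = expR (- (r i * v)).
Proof.
move=> iL rV v0 Vv; rewrite -exp_tail//.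
have pos1 : fine (P [set w | 0 < X (pi i) w]) = 1.
  by rewrite exp_tail// mulr0 oppr0 expR0.
have m0 := measurable_lt_set (@measurable_cst _ _ T R setT 0) (mX (pi i)).
have mv := measurable_lt_set (@measurable_cst _ _ T R setT v) (mX (pi i)).
have mV := measurable_pre (pi i) (measurable_ray rV).
have null : fine (P (~` [set w | 0 < X (pi i) w])) = 0.
  by rewrite probability_setC// fineB ?fin_num_measure// pos1 subrr.
apply/eqP; rewrite eq_le; apply/andP; split; last first.
  by apply: prob_fine_le => // w /= h; apply/Vv => //; exact: le_lt_trans h.
rewrite -[leRHS]addr0 -null -prob_fineU//.
- apply: prob_fine_le => //.
    by apply: measurableU => //; exact: measurableC.
  move=> w /= Vw; have [X0|X0] := ltP 0 (X (pi i) w).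
    by left; apply/Vv.
  by right => /=; apply/negP.
- exact: measurableC.
apply/seteqP; split=> w //= [h]; apply.
exact: le_lt_trans h.
Qed.

Lemma race_residual_cylinder (h : R) C : 0 <= h -> ray_cylinders C ->
  fine (P (race_won h `&` residual @^-1` C)) =
  fine (P (race_won h)) * fine (P ((fun w i => X i w) @^-1` C)).
Proof.
move=> h0 [s0 [V0 [us0 rV0 ->]]].
(* The cylinder is rewritten over [L ++ s]: every affected coordinate is tested, possibly against
   [setT], and then the remaining coordinates of [s0], on which [residual] subtracts 0. *)
set s := [seq i <- s0 | i \notin L].
set V := fun i => if i \in s0 then V0 i else setT.
have rV i : ray (V i) by rewrite /V; case: ifP => _ //; exact: rayT.
have us : uniq (L ++ s).
  rewrite cat_uniq uniqL filter_uniq// andbT/=.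
  by apply/hasPn => i; rewrite mem_filter => /andP[].
rewrite (@cylinderS R I s0 (L ++ s)); last first.
  by move=> i is0; rewrite mem_cat mem_filter is0 andbT orbN.
rewrite -/V.
have /choice[v Hv] i : exists v, 0 <= v /\ forall x, 0 < x -> V i x <-> v < x.
  by have [v v0 H] := ray_threshold (rV i); exists v.
have v0 i : 0 <= v i by case: (Hv i).
have Vv i x : 0 < x -> V i x <-> v i < x by case: (Hv i) => _; exact.
rewrite (_ : race_won h `&` _ = window 0 h `&` ahead s v V); last first.
  apply/seteqP; split=> w.
    case=> -[ww wL] H; split=> //; split=> i.
      move=> iL; have := H i; rewrite mem_cat iL /residual/= iL => /(_ isT).
      by move/Vv; rewrite subr_gt0 ltrBrDl; apply; exact: wL.
    move=> iss; have := H i; rewrite mem_cat iss orbT => /(_ isT).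
    rewrite /residual/= ifN ?subr0//.
    by move: iss; rewrite mem_filter => /andP[].
  case=> ww [H1 H2].
  have H0 i : i \in L -> c i * tau w < X (pi i) w.
    by move=> iL; apply: le_lt_trans (H1 i iL); rewrite lerDl.
  split; first by split.
  move=> i; rewrite mem_cat /residual; case: ifPn => [iL _|iL /= iss].
    by apply/Vv; rewrite ?subr_gt0 ?ltrBrDl; [exact: H0|exact: H1].
  by rewrite subr0; exact: H2.
rewrite ahead_factor// mulrC; congr (_ * _).
rewrite (_ : _ @^-1` _ = [set w | forall i, i \in L ++ s -> V i (X i w)])//.
rewrite indep// big_cat/=; congr (_ * _).
  apply: eq_big_seq => i iL.
  by rewrite -law_pi//; apply/esym/fine_prob_threshold => // x; exact: Vv.
by apply: eq_bigr => i _; rewrite law_pi.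
Qed.

End race.

(** * From cylinders to the sigma-algebra of paths *)

Section path_law.
Context d (T : measurableType d) (R : realType) (P : probability T R).
Context (I : choiceType).

Definition path_measurable : set (set (I -> R)) := <<s @ray_cylinders R I >>.

Lemma path_measurable_preimage (X : T -> I -> R) D :
  (forall i, measurable_fun setT (X ^~ i)) -> path_measurable D ->
  measurable (X @^-1` D).
Proof.
move=> mX; apply: (@dynkin_induction _ (g_sigma_algebraType (@ray_cylinders R I))
   (@ray_cylinders R I) (fun D => measurable (X @^-1` D))) => //.
- exact: ray_cylindersI.
- by rewrite preimage_setT.
- move=> _ [s [V [_ rV ->]]]; apply: (@measurable_forall_seq _ _ _ s) => i _.
  by rewrite -[X in measurable X]setTI; apply: mX => //; exact: measurable_ray.
- by move=> S _ mS; rewrite -preimage_setC; exact: measurableC.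
- by move=> F _ _ mF; rewrite preimage_bigcup; exact: bigcupT_measurable.
Qed.

(** Two finite measures that agree on a pi-system agree on what it generates, provided that their
    total masses agree: the cylinder [setT] gives [P G = p], which the complement step uses. *)
Lemma path_law_ext (G : set T) (X Y : T -> I -> R) (p : R) : measurable G ->
  (forall i, measurable_fun setT (X ^~ i)) ->
  (forall i, measurable_fun setT (Y ^~ i)) ->
  (forall C, ray_cylinders C ->
    fine (P (G `&` Y @^-1` C)) = p * fine (P (X @^-1` C))) ->
  forall D, path_measurable D ->
    fine (P (G `&` Y @^-1` D)) = p * fine (P (X @^-1` D)).
Proof.
move=> mG mX mY GYX.
have Gp : fine (P G) = p.
  have := GYX setT; rewrite !preimage_setT setIT probability_setT mulr1; apply.
  exists [::], (fun=> setT); split=> //; first by move=> i; exact: rayT.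
  by apply/seteqP; split.
have mXD D : path_measurable D -> measurable (X @^-1` D).
  exact: path_measurable_preimage.
have mYD D : path_measurable D -> measurable (Y @^-1` D).
  exact: path_measurable_preimage.
apply: (@dynkin_induction _ (g_sigma_algebraType (@ray_cylinders R I))
   (@ray_cylinders R I) (fun D => fine (P (G `&` Y @^-1` D)) =
                                  p * fine (P (X @^-1` D)))) => //.
- exact: ray_cylindersI.
- by rewrite !preimage_setT setIT probability_setT mulr1.
- move=> S mS H; rewrite -(preimage_setC X) -(preimage_setC Y).
  have mX1 : measurable (X @^-1` S) := mXD _ mS.
  have mY1 : measurable (Y @^-1` S) := mYD _ mS.
  move: (X @^-1` S) (Y @^-1` S) mX1 mY1 H => U V mU mV H.
  have := @prob_fineU _ _ _ P (G `&` V) (G `&` ~` V) (measurableI _ _ mG mV)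
     (measurableI _ _ mG (measurableC mV)).
  rewrite -setIUr setUv setIT Gp H setIACA setICr setI0 => /(_ erefl) GE.
  rewrite probability_setC// fineB ?fin_num_measure//= mulrBr mulr1 {1}GE.
  by rewrite addrAC subrr add0r.
- move=> F mF tF HF; rewrite !preimage_bigcup setI_bigcupr.
  have mXF n : measurable (X @^-1` F n) := mXD _ (mF n).
  have mYF n : measurable (G `&` Y @^-1` F n).
    by apply: measurableI => //; exact: (mYD _ (mF n)).
  apply/EFin_inj; rewrite EFinM -!prob_EFin; last 2 first.
  - exact: bigcupT_measurable.
  - exact: bigcupT_measurable.
  have tX : trivIset setT (fun n => X @^-1` F n).
    by move=> i j _ _ [w [Fi Fj]]; apply: tF => //; exists (X w).
  have tY : trivIset setT (fun n => G `&` Y @^-1` F n).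
    by move=> i j _ _ [w [[_ Fi] [_ Fj]]]; apply: tF => //; exists (Y w).
  rewrite !measure_semi_bigcup//; try exact: bigcupT_measurable.
  rewrite -nneseriesZl//.
  apply: eq_eseriesr => n _; apply: etrans (prob_EFin P (mYF n)) _.
  by rewrite HF EFinM; congr (_ * _)%E; exact/esym/(prob_EFin P (mXF n)).
Qed.

End path_law.

(** * Measurability of the sojourn time *)

Lemma measurable_prop d (T : measurableType d) (Q : Prop) :
  measurable [set w : T | Q].
Proof.
have [q|nq] := pselect Q.
  by rewrite (_ : mkset _ = setT)//; apply/seteqP; split.
by rewrite (_ : mkset _ = set0)//; apply/seteqP; split.
Qed.

Section measurable_cases.
Context d (T : measurableType d) (J : countType) (g : T -> J).
Hypothesis mg : forall j, measurable [set w | g w = j].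

(** A random parameter with countably many values may be treated as a constant. Tags, counters,
    batch sizes and masks of the queue dynamics are all frozen in this way. *)
Lemma measurable_set_cases (Q : J -> set T) :
  (forall j, measurable (Q j)) -> measurable [set w | Q (g w) w].
Proof.
move=> mQ.
rewrite (_ : [set w | _] = \bigcup_(j : J) ([set w | g w = j] `&` Q j)).
  by apply: countable_bigcupT_measurable => // j; exact: measurableI.
by apply/seteqP; split=> [w Qw|w [j _ [<-]]//]; exists (g w).
Qed.

Lemma measurable_fun_cases d' (U : measurableType d') (f : J -> T -> U) :
  (forall j, measurable_fun setT (f j)) ->
  measurable_fun setT (fun w => f (g w) w).
Proof.
move=> mf _ Y mY; rewrite setTI.
apply: (@measurable_set_cases (fun j => f j @^-1` Y)) => j.
by rewrite -[X in measurable X]setTI; exact: mf.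
Qed.

End measurable_cases.

Section measurable_jobs.
Context d (T : measurableType d) (R : realType).
Implicit Types (js : T -> seq (bool * R)) (f : T -> R).

(** A list of random length carries no ready measurable structure. The list of tags takes countably
    many values and determines the length; the requirements are then read one by one, with the
    default 0 beyond the end. *)
Definition measurable_jobs js : Prop :=
  (forall t : seq bool, measurable [set w | unzip1 (js w) = t]) /\
  (forall i, measurable_fun setT (fun w => (unzip2 (js w))`_i)).

Lemma measurable_jobs_cases (J : countType) (g : T -> J)
    (h : J -> T -> seq (bool * R)) :
  (forall j, measurable [set w | g w = j]) ->
  (forall j, measurable_jobs (h j)) -> measurable_jobs (fun w => h (g w) w).
Proof.
move=> mg mh; split=> [t|i].
  apply: (measurable_set_cases mg (Q := fun j w => unzip1 (h j w) = t)) => j.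
  exact: (mh j).1.
apply: (measurable_fun_cases mg (f := fun j w => (unzip2 (h j w))`_i)) => j.
exact: (mh j).2.
Qed.

Lemma measurable_jobs_map js (g : T -> R) : measurable_fun setT g ->
  measurable_jobs js ->
  measurable_jobs (fun w => serve (g w) (js w)).
Proof.
move=> mg [mt mr]; split=> [t|i].
  rewrite (_ : [set w | _] = [set w | unzip1 (js w) = t])//.
  by apply/seteqP; split=> w /=; rewrite /unzip1 /serve -map_comp.
have -> : (fun w => (unzip2 (serve (g w) (js w)))`_i) =
    (fun w => if (i < size (unzip1 (js w)))%N then
       (unzip2 (js w))`_i - g w / (size (unzip1 (js w)))%:R else 0).
  apply/funext => w; rewrite /unzip2 /unzip1 /serve size_map.
  have [iw|iw] := ltnP i (size (js w)); last by rewrite nth_default// !size_map.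
  by rewrite -map_comp !(nth_map (false, 0)).
apply: (measurable_fun_cases mt (f := fun t w => if (i < size t)%N then
       (unzip2 (js w))`_i - g w / (size t)%:R else 0)) => t.
case: ltnP => _ //; apply: measurable_funB => //.
exact: measurable_funM.
Qed.

(** Once mask and length are frozen, the entry kept at place [i] is an entry of [s] at a constant
    index. The default index [size s] is out of range, so that both sides are 0 when fewer than
    [i + 1] entries survive. *)
Lemma mask_nth (s : seq R) (m : seq bool) i :
  (mask m s)`_i = s`_(nth (size s) (mask m (iota 0 (size s))) i).
Proof.
rewrite -{1}(mkseq_nth 0 s) /mkseq -map_mask.
set l := mask m _.
have [il|il] := ltnP i (size l); first by rewrite (nth_map (size s)).
by rewrite nth_default ?size_map// !nth_default// nth_default.
Qed.

Lemma measurable_in_service js : measurable_jobs js ->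
  measurable_jobs (fun w => in_service (js w)).
Proof.
move=> [mt mr].
(* Filtering is masking by a random Boolean list, which has countably many values and can be
   frozen. *)
pose mk w := [seq 0 < x | x <- unzip2 (js w)].
have mmk m : measurable [set w | mk w = m].
  rewrite (_ : [set w | _] = [set w | size (unzip1 (js w)) = size m] `&`
    [set w | forall i, i \in iota 0 (size m) ->
                     (0 < (unzip2 (js w))`_i) = nth false m i]).
    apply: measurableI.
      apply: (measurable_set_cases mt (Q := fun t w => size t = size m)) => t.
      exact: measurable_prop.
    apply: measurable_forall_seq => i _.
    case: (nth false m i).
      by apply: measurable_lt_set.
    rewrite [X in measurable X](_ : _ = ~` [set w | 0 < (unzip2 (js w))`_i]).
      by apply: measurableC; exact: measurable_lt_set.
    by apply/seteqP; split=> w /=; [move=> ->|move/negP/negbTE].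
  apply/seteqP; split=> w /=.
    move=> <-; rewrite /mk !size_map; split=> // i.
    rewrite mem_iota add0n => /andP[_ im].
    by rewrite [RHS](nth_map 0) ?size_map.
  move=> [sm H]; apply: (@eq_from_nth _ false); rewrite /mk !size_map.
    by rewrite -sm size_map.
  move=> i im; rewrite (nth_map 0) ?size_map// H// mem_iota/= add0n -sm size_map//.
have E w : in_service (js w) = mask (mk w) (js w).
  by rewrite /in_service filter_mask /mk /unzip2 -map_comp.
have -> : (fun w => in_service (js w)) = (fun w => mask (mk w) (js w)).
  exact/funext.
apply: (measurable_jobs_cases (h := fun m w => mask m (js w)) mmk) => m.
split=> [t|i].
  rewrite (_ : [set w | _] = [set w | mask m (unzip1 (js w)) = t]).
    apply: (measurable_set_cases mt (Q := fun t' w => mask m t' = t)) => t'.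
    exact: measurable_prop.
  by apply/seteqP; split=> w /=; rewrite /unzip1 map_mask.
have -> : (fun w => (unzip2 (mask m (js w)))`_i) =
    (fun w => (unzip2 (js w))`_(nth (size (unzip1 (js w)))
       (mask m (iota 0 (size (unzip1 (js w))))) i)).
  by apply/funext => w; rewrite /unzip2 map_mask mask_nth !size_map.
exact: (measurable_fun_cases mt (f := fun t w =>
  (unzip2 (js w))`_(nth (size t) (mask m (iota 0 (size t))) i))).
Qed.

Lemma measurable_jobs_cat js js' : measurable_jobs js -> measurable_jobs js' ->
  measurable_jobs (fun w => js w ++ js' w).
Proof.
move=> [mt mr] [mt' mr']; split=> [t|i].
  rewrite (_ : [set w | _] = [set w | unzip1 (js w) ++ unzip1 (js' w) = t]).
    apply: (measurable_set_cases mt (Q := fun u w => u ++ unzip1 (js' w) = t)) => u.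
    apply: (measurable_set_cases mt' (Q := fun u' w => u ++ u' = t)) => u'.
    exact: measurable_prop.
  by apply/seteqP; split=> w /=; rewrite /unzip1 map_cat.
have -> : (fun w => (unzip2 (js w ++ js' w))`_i) =
    (fun w => if (i < size (unzip1 (js w)))%N then (unzip2 (js w))`_i
       else (unzip2 (js' w))`_(i - size (unzip1 (js w)))).
  by apply/funext => w; rewrite /unzip2 map_cat nth_cat !size_map.
apply: (measurable_fun_cases mt (f := fun t w => if (i < size t)%N then
  (unzip2 (js w))`_i else (unzip2 (js' w))`_(i - size t))) => t.
by case: ltnP.
Qed.

Lemma measurable_min_remaining js : measurable_jobs js ->
  measurable_fun setT (fun w => min_seq (unzip2 (js w))).
Proof.
move=> [mt mr].
have -> : (fun w => min_seq (unzip2 (js w))) =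
  (fun w => \big[Num.min/(unzip2 (js w))`_0]_(i <- iota 0 (size (unzip1 (js w))))
     (unzip2 (js w))`_i).
  apply/funext => w; rewrite /min_seq -nth0 -{2}(mkseq_nth 0 (unzip2 (js w))).
  by rewrite /mkseq big_map !size_map.
apply: (measurable_fun_cases mt (f := fun t w =>
  \big[Num.min/(unzip2 (js w))`_0]_(i <- iota 0 (size t)) (unzip2 (js w))`_i)) => t.
elim: (iota _ _) => [|i s IH].
  (under eq_fun do rewrite big_nil); exact: mr.
under eq_fun do rewrite big_cons.
exact: measurable_minr.
Qed.

Lemma measurable_completion_time js : measurable_jobs js ->
  measurable_fun setT (fun w => completion_time (js w)).
Proof.
move=> mjs; apply: measurable_funM; last exact: measurable_min_remaining.
have -> : (fun w => (size (js w))%:R : R) = (fun w => (size (unzip1 (js w)))%:R).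
  by apply/funext => w; rewrite size_map.
by case: mjs => mt _; apply: (measurable_fun_cases mt (f := fun t w => (size t)%:R : R)) => t.
Qed.

Lemma measurable_nilp_jobs js : measurable_jobs js ->
  measurable_fun setT (fun w => nilp (js w)).
Proof.
move=> [mt _].
have -> : (fun w => nilp (js w)) = (fun w => nilp (unzip1 (js w))).
  by apply/funext => w; case: (js w).
apply: (measurable_fun_cases mt (f := fun t w => nilp t)) => t.
exact: measurable_cst.
Qed.

Lemma measurable_new_jobs tagged (S : nat -> T -> R) j m :
  (forall k, measurable_fun setT (S k)) ->
  measurable_jobs (fun w => new_jobs tagged (fun k => S k w) j m).
Proof.
move=> mS; split=> [t|i].
  have E w : unzip1 (new_jobs tagged (fun k => S k w) j m) = nseq m tagged.
    by rewrite /unzip1 /new_jobs; elim: m j => //= m IH j; rewrite IH.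
  by under eq_fun do rewrite E; exact: measurable_prop.
have [im|im] := ltnP i m; last first.
  under eq_fun do rewrite nth_default ?size_map ?size_iota//.
  exact: measurable_cst.
under eq_fun => w.
  rewrite /unzip2 /new_jobs -map_comp (nth_map 0%N) ?size_iota//= nth_iota//.
  over.
exact: mS.
Qed.

End measurable_jobs.

Section measurable_sojourn.
Context d (T : measurableType d) (R : realType).
Context (A : nat -> T -> R) (B : nat -> T -> nat) (S : nat -> T -> R).
Hypothesis mA : forall k, measurable_fun setT (A k).
Hypothesis mB : forall k m, measurable [set w | B k w = m].
Hypothesis mS : forall j, measurable_fun setT (S j).

Definition measurable_state (f : T -> queue_state R) : Prop :=
  [/\ measurable_fun setT (fun w => clock (f w)),
      measurable_fun setT (fun w => next_arrival (f w)),
      forall k, measurable [set w | batches (f w) = k],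
      forall k, measurable [set w | drawn (f w) = k] &
      measurable_jobs (fun w => jobs (f w))].

Lemma measurable_state_if (c : T -> bool) f g : measurable_fun setT c ->
  measurable_state f -> measurable_state g ->
  measurable_state (fun w => if c w then f w else g w).
Proof.
move=> mc [f1 f2 f3 f4 f5] [g1 g2 g3 g4 g5].
have mcb b : measurable [set w | c w = b].
  by rewrite -[X in measurable X]setTI; exact: (mc measurableT [set b]).
have E U (h : queue_state R -> U) w :
    h (if c w then f w else g w) = if c w then h (f w) else h (g w).
  by case: (c w).
split.
- under eq_fun do rewrite E.
  by apply: (measurable_fun_cases mcb (f := fun b w => if b then _ else _)); case.
- under eq_fun do rewrite E.
  by apply: (measurable_fun_cases mcb (f := fun b w => if b then _ else _)); case.
- move=> k; apply: (measurable_set_cases mcb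
    (Q := fun b w => batches (if b then f w else g w) = k)).
  by case; [exact: f3|exact: g3].
- move=> k; apply: (measurable_set_cases mcb
    (Q := fun b w => drawn (if b then f w else g w) = k)).
  by case; [exact: f4|exact: g4].
- under eq_fun do rewrite E.
  by apply: (measurable_jobs_cases mcb (h := fun b w => if b then _ else _)); case.
Qed.

Let step (f : T -> queue_state R) w :=
  ps_step (A^~ w) (B^~ w) (S^~ w) (f w).

Lemma measurable_state_step f : measurable_state f -> measurable_state (step f).
Proof.
move=> [f1 f2 f3 f4 f5].
have mt : measurable_fun setT (fun w => holding_time (f w)).
  apply: measurable_fun_ifT => //; first exact: measurable_nilp_jobs.
  by apply: measurable_minr => //; exact: measurable_completion_time.
have mBb m : measurable [set w | B (batches (f w)) w = m].
  by apply: (measurable_set_cases f3 (Q := fun k w => B k w = m)) => k; exact: mB.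
have mjs : measurable_jobs
    (fun w => in_service (serve (holding_time (f w)) (jobs (f w)))).
  by apply: measurable_in_service; exact: measurable_jobs_map.
apply: measurable_state_if.
- exact: measurable_fun_eqr.
- split=> /=.
  + exact: measurable_funD.
  + by apply: (measurable_fun_cases f3 (f := fun k w => A k.+1 w)) => k; exact: mA.
  + move=> k; apply: (measurable_set_cases f3 (Q := fun j w => j.+1 = k)) => j.
    exact: measurable_prop.
  + move=> k.
    apply: (measurable_set_cases f4 (Q := fun j w => (j + B (batches (f w)) w)%N = k)) => j.
    apply: (measurable_set_cases mBb (Q := fun m w => (j + m)%N = k)) => m.
    exact: measurable_prop.
  + apply: measurable_jobs_cat => //.
    apply: (measurable_jobs_cases f4 (h := fun j w =>
      new_jobs false (S^~ w) j (B (batches (f w)) w))) => j.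
    apply: (measurable_jobs_cases mBb (h := fun m w =>
      new_jobs false (S^~ w) j m)) => m.
    exact: measurable_new_jobs.
- split=> //=.
  + exact: measurable_funD.
  + exact: measurable_funB.
Qed.

Lemma measurable_ps_state n b N :
  measurable_state (fun w => ps_state (A^~ w) (B^~ w) (S^~ w) n b N).
Proof.
elim: N => [|N IH]; last exact: measurable_state_step.
split=> //=.
- by move=> k; exact: measurable_prop.
- by move=> k; exact: measurable_prop.
- by apply: measurable_jobs_cat; exact: measurable_new_jobs.
Qed.

(** The sojourn time is an infimum, which need not be assumed attained: it is at most [y] exactly
    when, for each [k], some completed state has its clock below [y + k.+1%:R^-1]. *)
Lemma measurable_sojourn_gt n b (y : R) :
  measurable [set w | (y%:E < batch_sojourn (A^~ w) (B^~ w) (S^~ w) n b)%E].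
Proof.
rewrite [X in measurable X](_ : _ = ~` \bigcap_k \bigcup_N
  ([set w | batch_completed (ps_state (A^~ w) (B^~ w) (S^~ w) n b N)] `&`
   [set w | clock (ps_state (A^~ w) (B^~ w) (S^~ w) n b N) < y + k.+1%:R^-1])).
  apply: measurableC; apply: bigcapT_measurable => k.
  apply: bigcupT_measurable => N; have [f1 _ _ _ [mt _]] := measurable_ps_state n b N.
  apply: measurableI; last by apply: measurable_lt_set.
  rewrite [X in measurable X](_ : _ = [set w | ~~ has id
      (unzip1 (jobs (ps_state (A^~ w) (B^~ w) (S^~ w) n b N)))]).
    apply: (measurable_set_cases mt (Q := fun t w => ~~ has id t)) => t.
    exact: measurable_prop.
  by apply/seteqP; split=> w /=; rewrite /batch_completed /unzip1 has_map.
apply/seteqP; split=> w /=.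
  move=> yw H.
  have Hk k : (batch_sojourn (A^~ w) (B^~ w) (S^~ w) n b <
               (y + k.+1%:R^-1)%:E)%E.
    have [N _ [cN tN]] := H k I.
    by apply/ereal_inf_ltP; exists (clock (ps_state (A^~ w) (B^~ w) (S^~ w) n b N))%:E;
      [exists N|rewrite lte_fin].
  move: yw Hk; case: (batch_sojourn _ _ _ _ _) => [r| |] // yr Hk.
    rewrite lte_fin in yr.
    have [k kr] : exists k : nat, (r - y)^-1 < k%:R.
      by exists (Num.truncn (r - y)^-1).+1; rewrite truncnS_gt.
    have := Hk k; rewrite lte_fin -ltrBlDl => rk.
    have ry : 0 < r - y by rewrite subr_gt0.
    suff : k.+1%:R^-1 < r - y by rewrite ltNge (ltW rk).
    rewrite invf_plt ?posrE//; apply: lt_trans kr _; by rewrite ltr_nat.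
  by have := Hk 0%N; rewrite ltNge leey.
apply: contra_notT; rewrite -leNgt => yw k _.
have : (batch_sojourn (A^~ w) (B^~ w) (S^~ w) n b < (y + k.+1%:R^-1)%:E)%E.
  by apply: le_lt_trans yw _; rewrite lte_fin ltrDl.
by move=> /ereal_inf_ltP[_ [N cN <-]]; rewrite lte_fin => tN; exists N.
Qed.

End measurable_sojourn.

(** * Shifting a sample path by one event *)

Section sample_path_shift.
Context (R : realType).
Implicit Types (A S : nat -> R) (B : nat -> nat).

(* [st] is the state of the queue fed by (A, B, S), [st'] that of the queue fed
   by (A', B', S') after time has been shifted by [t]; only the primitives not
   yet used have to coincide. *)
Definition shifted (t : R) (db dd : nat) (st st' : queue_state R) : Prop :=
  [/\ clock st = t + clock st', next_arrival st = next_arrival st',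
      batches st = (db + batches st')%N, drawn st = (dd + drawn st')%N &
      jobs st = jobs st'].

Lemma shifted_step (t : R) db dd d0 A B S A' B' S' st st' :
    (forall k, A (db + k).+1 = A' k.+1) ->
    (forall k, B (db + k)%N = B' k) ->
    (forall j, (d0 <= j)%N -> S (dd + j)%N = S' j) ->
    (d0 <= drawn st')%N ->
    shifted t db dd st st' ->
  shifted t db dd (ps_step A B S st) (ps_step A' B' S' st') /\
  (d0 <= drawn (ps_step A' B' S' st'))%N.
Proof.
move=> HA HB HS d0st; case: st st' d0st => [c a k j js] [c' a' k' j' js'] /= d0j.
move=> [/= -> -> -> -> ->]; rewrite /ps_step /holding_time /=.
case: ifP => _ /=; split=> //.
- split=> /=; rewrite ?addrA ?HA ?HB ?addnA ?addnS//.
  congr (_ ++ _); rewrite /new_jobs -[X in iota X _](addnC j' dd) addnC iotaDl -map_comp.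
  apply/eq_in_map => i; rewrite mem_iota => /andP[ji _] /=.
  by rewrite HS// (leq_trans d0j).
- by rewrite (leq_trans d0j)// leq_addr.
- by split=> //=; rewrite addrA.
Qed.

Lemma shifted_iter (t : R) db dd d0 A B S A' B' S' st st' N :
    (forall k, A (db + k).+1 = A' k.+1) ->
    (forall k, B (db + k)%N = B' k) ->
    (forall j, (d0 <= j)%N -> S (dd + j)%N = S' j) ->
    (d0 <= drawn st')%N ->
    shifted t db dd st st' ->
  shifted t db dd (iter N (ps_step A B S) st) (iter N (ps_step A' B' S') st').
Proof.
move=> HA HB HS d0st H.
suff [] : shifted t db dd (iter N (ps_step A B S) st) (iter N (ps_step A' B' S') st')
   /\ (d0 <= drawn (iter N (ps_step A' B' S') st'))%N by [].
by elim: N => [//|N [IH d0N]]; exact: shifted_step IH.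
Qed.

Lemma init_not_completed A S n b : (0 < b)%N -> ~~ batch_completed (ps_init A S n b).
Proof. by case: b => // b _; rewrite /batch_completed. Qed.

(** The reindexings [f] and [g] of completed states give one inequality each between the two infima.
    Both infima are +oo when no state is completed. *)
Lemma sojourn_shift_of (A A' S S' : nat -> R) B B' n b n' b' (t : R) (f g : nat -> nat) :
    (forall N, batch_completed (ps_state A B S n b N) ->
       batch_completed (ps_state A' B' S' n' b' (f N)) /\
       clock (ps_state A B S n b N) = t + clock (ps_state A' B' S' n' b' (f N))) ->
    (forall N, batch_completed (ps_state A' B' S' n' b' N) ->
       batch_completed (ps_state A B S n b (g N)) /\
       clock (ps_state A B S n b (g N)) = t + clock (ps_state A' B' S' n' b' N)) ->
  forall y : R, (y%:E < batch_sojourn A B S n b)%E =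
    ((y - t)%:E < batch_sojourn A' B' S' n' b')%E.
Proof.
move=> Hf Hg y.
suff -> : batch_sojourn A B S n b = (t%:E + batch_sojourn A' B' S' n' b')%E.
  by rewrite EFinB lteBlDl.
apply/eqP; rewrite eq_le; apply/andP; split.
  rewrite -leeBlDl//; apply/ereal_infP => _ [N cN <-].
  have [cgN tgN] := Hg N cN.
  rewrite leeBlDl//; apply: ereal_inf_lbound; exists (g N) => //.
  by rewrite tgN EFinD.
apply/ereal_infP => _ [N cN <-]; have [cfN tfN] := Hf N cN.
rewrite tfN EFinD leeD2lE//.
by apply: ereal_inf_lbound; exists (f N).
Qed.

(** State N + 1 of the first queue is state N of the second one; state 0 of the first is not
    completed as [b] is positive. *)
Lemma sojourn_after_event (t : R) db dd d0 A B S A' B' S' n b n' b' :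
    (0 < b)%N ->
    (forall k, A (db + k).+1 = A' k.+1) ->
    (forall k, B (db + k)%N = B' k) ->
    (forall j, (d0 <= j)%N -> S (dd + j)%N = S' j) ->
    (d0 <= b' + n')%N ->
    shifted t db dd (ps_step A B S (ps_init A S n b)) (ps_init A' S' n' b') ->
  forall y : R, (y%:E < batch_sojourn A B S n b)%E =
    ((y - t)%:E < batch_sojourn A' B' S' n' b')%E.
Proof.
move=> b0 HA HB HS d0n H.
have sh N : shifted t db dd (ps_state A B S n b N.+1) (ps_state A' B' S' n' b' N).
  by rewrite /ps_state iterSr; apply: (shifted_iter N HA HB HS).
apply: (@sojourn_shift_of _ _ _ _ _ _ _ _ _ _ _ predn succn) => [[|N]|N].
- by rewrite /ps_state/= (negbTE (init_not_completed A S n b0)).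
- by rewrite /batch_completed; have [-> _ _ _ ->] := sh N.
- by rewrite /batch_completed; have [-> _ _ _ ->] := sh N.
Qed.

(** Time has advanced inside a holding period, so the two queues agree up to the shift only from
    their first event on; neither initial state is completed, so index 0 does not count. *)
Lemma sojourn_no_event (t : R) A B S A' B' S' n b d0 :
    (0 < b)%N ->
    (forall k, A k.+1 = A' k.+1) -> (forall k, B k = B' k) ->
    (forall j, (d0 <= j)%N -> S j = S' j) ->
    (d0 <= drawn (ps_step A' B' S' (ps_init A' S' n b)))%N ->
    shifted t 0 0 (ps_step A B S (ps_init A S n b))
                  (ps_step A' B' S' (ps_init A' S' n b)) ->
  forall y : R, (y%:E < batch_sojourn A B S n b)%E =
    ((y - t)%:E < batch_sojourn A' B' S' n b)%E.
Proof.
move=> b0 HA HB HS d0n H.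
have sh N : shifted t 0 0 (ps_state A B S n b N.+1) (ps_state A' B' S' n b N.+1).
  by rewrite /ps_state !iterSr; apply: (shifted_iter N HA HB HS).
apply: (@sojourn_shift_of _ _ _ _ _ _ _ _ _ _ _ id id) => [[|N]|[|N]].
- by rewrite /ps_state/= (negbTE (init_not_completed A S n b0)).
- by rewrite /batch_completed; have [-> _ _ _ ->] := sh N.
- by rewrite /ps_state/= (negbTE (init_not_completed A' S' n b0)).
- by rewrite /batch_completed; have [-> _ _ _ ->] := sh N.
Qed.

(** Tag and requirement are functions of one index, the tagged jobs being the first [b], so that
    removing or renumbering jobs is arithmetic on indices. *)
Definition init_jobs S n b : seq (bool * R) :=
  [seq ((i < b)%N, S i) | i <- iota 0 (b + n)].

Lemma ps_initE A S n b : ps_init A S n b = QueueState 0 (A 0%N) 0 (b + n) (init_jobs S n b).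
Proof.
rewrite /ps_init /init_jobs; congr QueueState; rewrite iotaD map_cat add0n.
congr (_ ++ _); apply/eq_in_map => i; rewrite mem_iota.
  by rewrite add0n => /andP[_ ->].
by move=> /andP[bi _]; rewrite ltnNge bi.
Qed.

Lemma min_seq_mem (s : seq R) : (0 < size s)%N -> min_seq s \in s.
Proof.
move=> s0; rewrite /min_seq big_seq; apply: (big_ind (fun x => x \in s)) => //.
  by case: s s0 => // a s _; rewrite mem_head.
by move=> x y xs ys; rewrite minEle; case: ifP.
Qed.

Lemma min_seq_le (s : seq R) x : x \in s -> min_seq s <= x.
Proof. by move=> xs; exact: ge_bigmin_seq. Qed.

Lemma min_seq_eq (s : seq R) m : m \in s -> (forall x, x \in s -> m <= x) ->
  min_seq s = m.
Proof.
move=> ms H; apply/eqP; rewrite eq_le min_seq_le//= H// min_seq_mem//.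
by case: s ms {H}.
Qed.

Lemma size_init_jobs S n b : size (init_jobs S n b) = (b + n)%N.
Proof. by rewrite size_map size_iota. Qed.

Lemma init_remaining S n b : unzip2 (init_jobs S n b) = [seq S i | i <- iota 0 (b + n)].
Proof. by rewrite /unzip2 /init_jobs -map_comp. Qed.

Lemma nilp_init_jobs S n b : (0 < b)%N -> nilp (init_jobs S n b) = false.
Proof. by case: b. Qed.

Lemma serve_init_jobs (t : R) S n b : serve t (init_jobs S n b) =
  [seq ((i < b)%N, S i - (b + n)%:R^-1 * t) | i <- iota 0 (b + n)].
Proof.
by rewrite /serve size_init_jobs -map_comp; apply: eq_map => i /=; rewrite mulrC.
Qed.

Let size_gt0 n b : (0 < b)%N -> (0 : R) < (b + n)%:R.
Proof. by move=> b0; rewrite ltr0n addn_gt0 b0. Qed.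

Lemma completion_time_gt (t : R) S n b : (0 < b)%N ->
  (forall j, (j < b + n)%N -> (b + n)%:R^-1 * t < S j) ->
  t < completion_time (init_jobs S n b).
Proof.
move=> b0 H; rewrite /completion_time size_init_jobs init_remaining.
have : min_seq [seq S i | i <- iota 0 (b + n)] \in [seq S i | i <- iota 0 (b + n)].
  by apply: min_seq_mem; rewrite size_map size_iota addn_gt0 b0.
case/mapP => j; rewrite mem_iota add0n /= => jk ->.
by have := H j jk; rewrite ltr_pdivrMl// size_gt0.
Qed.

(** The new jobs are numbered from [b + n] on, just after those present, so the service sequence
    keeps its numbering while the arrival and batch sequences advance by one. *)
Lemma sojourn_arrival A S B n b : (0 < b)%N ->
    (forall j, (j < b + n)%N -> (b + n)%:R^-1 * A 0%N < S j) ->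
  forall y : R, (y%:E < batch_sojourn A B S n b)%E =
    ((y - A 0%N)%:E < batch_sojourn (A \o succn) (B \o succn)
       (fun j => S j - (if (j < b + n)%N then (b + n)%:R^-1 * A 0%N else 0))%R
       (n + B 0%N)%N b)%E.
Proof.
move=> b0 HS; apply: (@sojourn_after_event _ 1 0 (b + n)) => //.
- by move=> j; rewrite ltnNge => ->; rewrite subr0.
- by rewrite addnA leq_addr.
rewrite !ps_initE /ps_step /holding_time /= nilp_init_jobs// min_l; last first.
  exact/ltW/completion_time_gt.
rewrite eqxx; split=> //=; rewrite ?add0r ?addr0 ?addn0 ?addnA//.
rewrite serve_init_jobs /in_service (all_filterP _); last first.
  apply/allP => _ /mapP[j + ->]; rewrite mem_iota add0n => /= jk.
  by rewrite subr_gt0 HS.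
rewrite /init_jobs addnA (iotaD 0 (b + n)) map_cat add0n; congr (_ ++ _).
  by apply/eq_in_map => i; rewrite mem_iota add0n => /= ->.
apply/eq_in_map => i; rewrite mem_iota => /andP[ki _].
by rewrite !ltnNge ki (leq_trans (leq_addr n b) ki) subr0.
Qed.

(** Subtracting [t] from the arrival clock and [t / (b + n)] from each requirement subtracts [t]
    from both arguments of the minimum in [holding_time], and the first event leads to the same
    jobs. This is an algebraic identity, valid for every real [t]. *)
Lemma sojourn_quiet (t : R) A S B n b : (0 < b)%N ->
  forall y : R, (y%:E < batch_sojourn A B S n b)%E =
    ((y - t)%:E < batch_sojourn (fun k => A k - (if k is 0%N then t else 0))%R B
       (fun j => S j - (if (j < b + n)%N then (b + n)%:R^-1 * t else 0))%R
       n b)%E.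
Proof.
move=> b0.
pose A' k := A k - (if k is 0%N then t else 0).
pose S' j := S j - (if (j < b + n)%N then (b + n)%:R^-1 * t else 0).
have js' : init_jobs S' n b = serve t (init_jobs S n b).
  rewrite serve_init_jobs; apply/eq_in_map => i; rewrite mem_iota add0n => /= ik.
  by rewrite /S' ik.
have k0 := size_gt0 n b0.
have kn0 : (b + n)%:R != 0 :> R by rewrite gt_eqF.
have ct : completion_time (init_jobs S' n b) = completion_time (init_jobs S n b) - t.
  rewrite /completion_time !size_init_jobs !init_remaining.
  rewrite (_ : _ - t = (b + n)%:R *
     (min_seq [seq S i | i <- iota 0 (b + n)] - (b + n)%:R^-1 * t)); last first.
    by rewrite mulrBr mulrA mulfV// mul1r.
  congr (_ * _); apply: min_seq_eq.
    have : min_seq [seq S i | i <- iota 0 (b + n)] \in [seq S i | i <- iota 0 (b + n)].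
      by apply: min_seq_mem; rewrite size_map size_iota addn_gt0 b0.
    case/mapP => j jk ->; apply/mapP; exists j => //.
    by move: jk; rewrite mem_iota add0n /S' => /= ->.
  move=> _ /mapP[j jk ->]; rewrite /S'.
  move: (jk); rewrite mem_iota add0n => /= ->; rewrite lerD2r.
  by apply: min_seq_le; exact: map_f.
apply: (@sojourn_no_event t A B S A' B S' n b (b + n)) => //.
- by move=> k; rewrite /A' subr0.
- by move=> j; rewrite /S' ltnNge => ->; rewrite subr0.
- by rewrite ps_initE /ps_step; case: ifP => _ /=; rewrite ?leq_addr.
rewrite !ps_initE /ps_step /holding_time /= !nilp_init_jobs// ct /A'.
rewrite -addr_minl; set t0 := Num.min _ _.
have js2 : serve (t0 - t) (init_jobs S' n b) = serve t0 (init_jobs S n b).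
  rewrite js' {1}/serve size_map size_init_jobs serve_init_jobs -map_comp serve_init_jobs.
  by apply: eq_map => i /=; congr pair; ring.
rewrite js2 (inj_eq (addIr _)); case: ifP => _; split=> //=.
- by rewrite !add0r addrC subrK.
- by rewrite subr0.
- congr (_ ++ _); apply/eq_in_map => i; rewrite mem_iota => /andP[ki _].
  by rewrite /S' ltnNge ki subr0.
- by rewrite !add0r addrC subrK.
- by ring.
Qed.

Lemma ltn_unbump (k i j : nat) : (i < k)%N -> (j < k)%N -> j != i ->
  (unbump i j < k.-1)%N.
Proof. by rewrite /unbump; case: ltnP => /=; lia. Qed.

Lemma iota_remove (k i : nat) : (i < k)%N ->
  [seq j <- iota 0 k | j != i] = [seq bump i j | j <- iota 0 k.-1].
Proof.
move=> ik; have -> : k.-1 = (i + (k - i.+1))%N by lia.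
rewrite {1}(_ : k = i + (1 + (k - i.+1)))%N; last by lia.
rewrite !iotaD !filter_cat map_cat /= !add0n eqxx addn1 /=; congr (_ ++ _).
  rewrite (all_filterP _); last first.
    by apply/allP => j; rewrite mem_iota add0n => /= ji; rewrite ltn_eqF.
  rewrite -[LHS]map_id; apply/eq_in_map => j; rewrite mem_iota add0n => /= ji.
  by rewrite /bump leqNgt ji.
rewrite (all_filterP _); last first.
  by apply/allP => j; rewrite mem_iota => /andP[ij _]; rewrite gtn_eqF.
rewrite -addn1 addnC iotaDl; apply/eq_in_map => j; rewrite mem_iota => /andP[ij _].
by rewrite /bump ij.
Qed.

(** [bump i] closes the gap left by job [i] and keeps the tagged jobs in front. The product of
    [(b + n)%:R^-1] and [(b + n)%:R * S i] is not simplified because [residual] produces speed times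
    elapsed time in this form. *)
Lemma sojourn_completion A S B n b i : (0 < b)%N -> (i < b + n)%N ->
    (b + n)%:R * S i < A 0%N ->
    (forall j, (j < b + n)%N -> j != i -> S i < S j) ->
  forall y : R, (y%:E < batch_sojourn A B S n b)%E =
    ((y - (b + n)%:R * S i)%:E <
       batch_sojourn (fun k => A k - (if k is 0%N then (b + n)%:R * S i else 0))%R B
       (fun j => S (bump i j) -
         (if (j < (b + n).-1)%N then (b + n)%:R^-1 * ((b + n)%:R * S i) else 0))%R
       (n - (b <= i))%N (b - (i < b))%N)%E.
Proof.
move=> b0 ik HA HS.
have k0 := size_gt0 n b0.
have kn0 : (b + n)%:R != 0 :> R by rewrite gt_eqF.
have nb : (b - (i < b) + (n - (b <= i)) = (b + n).-1)%N by case: ltnP; lia.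
have ct : completion_time (init_jobs S n b) = (b + n)%:R * S i.
  rewrite /completion_time size_init_jobs init_remaining; congr (_ * _).
  apply: min_seq_eq; first by apply: map_f; rewrite mem_iota.
  move=> _ /mapP[j + ->]; rewrite mem_iota add0n => /= jk.
  by have [->//|ji] := eqVneq j i; exact/ltW/HS.
apply: (@sojourn_after_event _ 0 1 (b + n).-1) => //.
- by move=> k; rewrite subr0.
- move=> j kj; rewrite ltnNge kj subr0 /bump (_ : (i <= j)%N)//; lia.
- by rewrite nb.
rewrite !ps_initE nb /ps_step /holding_time /= nilp_init_jobs// ct min_r ?(ltW HA)//.
rewrite gt_eqF//; split=> //=.
- by rewrite addrC.
- by lia.
(* Job [i] has exactly 0 left and is filtered out; the strict inequalities [HS] keep all the
   others. *)
rewrite serve_init_jobs mulKf// /in_service filter_map.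
rewrite (eq_in_filter (a2 := fun j => j != i)); last first.
  move=> j; rewrite mem_iota add0n => /= jk; rewrite subr_gt0.
  by have [->|ji] := eqVneq j i; [rewrite ltxx|exact: HS].
rewrite iota_remove// -map_comp /init_jobs nb.
apply/eq_in_map => j; rewrite mem_iota add0n => /= jk; rewrite jk; congr pair.
by rewrite /bump; case: (ltnP i b); case: (leqP i j); lia.
Qed.

End sample_path_shift.

(** * Exponential tails and the path space of the primitives *)

Section exponential_tail.
Context (R : realType) (rate : R).
Context d (T : measurableType d) (P : probability T R) (X : T -> R).
Hypothesis mX : measurable_fun setT X.
Hypothesis law : forall V : set R, measurable V ->
  P (X @^-1` V) = exponential_prob rate V.

Lemma prob_exponential_tail (a : R) : 0 <= a ->
  fine (P [set w | a < X w]) = expR (- (rate * a)).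
Proof.
move=> a0.
have mpre (V : set R) : measurable V -> measurable (X @^-1` V).
  by move=> mV; rewrite -[X in measurable X]setTI; exact: mX.
have neg : fine (P (X @^-1` `]-oo, 0[%classic)) = 0.
  rewrite law// /exponential_prob integral0_eq// => x; rewrite /= in_itv/= => x0.
  by rewrite lt0_exponential_pdf.
have nonneg : fine (P (X @^-1` `[0, a]%classic)) = 1 - expR (- (rate * a)).
  (* For [a = 0] the interval is a single point, with null integral. *)
  move: a0; rewrite le_eqVlt => /predU1P[<-|a0].
    rewrite mulr0 oppr0 expR0 subrr law//.
    by rewrite /exponential_prob set_itv1 integral_set1.
  by rewrite law// exponential_prob_itv0c//= mulNr.
rewrite (_ : [set w | a < X w] =
    ~` (X @^-1` `]-oo, 0[%classic `|` X @^-1` `[0, a]%classic)); last first.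
  apply/seteqP; split=> w /=; rewrite !in_itv/=.
    move=> aX [X0|/andP[_ Xa]].
      by have := lt_trans X0 (le_lt_trans a0 aX); rewrite ltxx.
    by rewrite ltNge Xa in aX.
  move=> H; rewrite ltNge; apply/negP => Xa; apply: H.
  by have [X0|X0] := ltP (X w) 0; [left|right; rewrite Xa].
rewrite probability_setC; last by apply: measurableU; exact: mpre.
rewrite fineB ?fin_num_measure//; last by apply: measurableU; exact: mpre.
rewrite prob_fineU ?neg ?nonneg ?add0r /=; [by rewrite opprB addrC subrK| | |].
- exact: mpre.
- exact: mpre.
- apply/seteqP; split=> w //=; rewrite !in_itv/= => -[h /andP[h' _]].
  by move: h; rewrite ltNge h'.
Qed.

End exponential_tail.

Section coordinates.
Context (R : realType).

Definition source : Type := (nat + nat + nat)%type.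

(* Batch sizes are stored as reals, so that a realization of all the primitives
   is a single family of reals. *)
Definition path_sojourn (f : source -> R) (n b : nat) : \bar R :=
  batch_sojourn (fun k => f (inl (inl k)))
    (fun k => Num.truncn (f (inl (inr k)))) (fun j => f (inr j)) n b.

Definition longer (n b : nat) (y : R) : set (source -> R) :=
  [set f | (y%:E < path_sojourn f n b)%E].

(** The path space with its generated sigma-algebra plays the role of the sample space in
    [measurable_sojourn_gt], the primitives being the coordinate maps. *)
Lemma path_measurable_longer n b y : path_measurable (longer n b y).
Proof.
pose G := g_sigma_algebraType (@ray_cylinders R source).
have mc (i : source) : measurable_fun setT (fun f : G => f i : R).
  apply: (measurability _ (RGenOInfty.measurableE R)) => //.
  move=> _ [_ [a ->] <-]; rewrite setTI.
  apply: sub_sigma_algebra; exists [:: i], (fun=> `]a, +oo[%classic); split=> //.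
    by move=> _; right; exists a.
  apply/seteqP; split=> f /=; first by move=> H j; rewrite mem_seq1 => /eqP ->.
  by apply; rewrite mem_head.
apply: (@measurable_sojourn_gt _ G R (fun k f => f (inl (inl k)))
  (fun k f => Num.truncn (f (inl (inr k)))) (fun j f => f (inr j))) => // k m.
(* [Num.truncn] sends everything below 1, negative numbers included, to 0; hence no lower constraint
   for [m = 0]. *)
rewrite [X in measurable X](_ : _ = [set f : G | f (inl (inr k)) < m.+1%:R] `&`
  ~` (if m is 0%N then set0 else [set f : G | f (inl (inr k)) < m%:R])).
  apply: measurableI; first by apply: measurable_lt_set.
  by apply: measurableC; case: m => // m; apply: measurable_lt_set.
apply/seteqP; split=> f /=.
  move=> <-; split; first exact: truncnS_gt.
  case E : (Num.truncn _) => [|m'] //=; apply/negP; rewrite -leNgt -truncn_gt_nat E//.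
move=> [h1 h2]; apply/eqP; rewrite eqn_leq truncn_le_nat h1 /=.
by case: m h1 h2 => // m h1 /= /negP; rewrite -leNgt -truncn_gt_nat.
Qed.

End coordinates.

(** * The first event *)

Section first_event.
Context d (T : measurableType d) (R : realType) (P : probability T R).
Context (rho : R) (q : nat -> R) (A : nat -> {RV P >-> R})
  (B : nat -> {RV P >-> nat}) (S : nat -> {RV P >-> R}).
Hypothesis rho_gt0 : 0 < rho.
Hypothesis q_law : batch_size_law q.
Hypothesis queue : batch_queue_primitives rho q A B S.

Definition coord (i : source) : T -> R :=
  match i with
  | inl (inl k) => A k
  | inl (inr k) => fun w => (B k w)%:R
  | inr j => S j
  end.

Definition tail (n b : nat) (y : R) : R :=
  fine (P [set w | (y%:E < Omega A B S n b w)%E]).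

Let path (w : T) : source -> R := fun i => coord i w.

Lemma Omega_path n b w : Omega A B S n b w = path_sojourn (path w) n b.
Proof.
rewrite /Omega /path_sojourn; congr batch_sojourn.
by apply/funext => k; rewrite /path /= natrK.
Qed.

Lemma measurable_coord i : measurable_fun setT (coord i).
Proof.
case: i => [[k|k]|j] //=.
move=> _ V mV; rewrite setTI.
by rewrite (_ : _ @^-1` V = B k @^-1` [set m | V m%:R])//; exact: measurable_funPTI.
Qed.

Let mpre i (V : set R) : measurable V -> measurable (coord i @^-1` V).
Proof. by move=> mV; rewrite -[X in measurable X]setTI; exact: measurable_coord. Qed.

Lemma tailE n b y : tail n b y = fine (P (path @^-1` longer n b y)).
Proof.
by rewrite /tail; congr (fine (P _)); apply/seteqP; split=> w /=; rewrite Omega_path.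
Qed.

Lemma measurable_sojourn_longer n b y :
  measurable [set w | (y%:E < Omega A B S n b w)%E].
Proof.
rewrite (_ : mkset _ = path @^-1` longer n b y).
  by apply: path_measurable_preimage; [exact: measurable_coord|exact: path_measurable_longer].
by apply/seteqP; split=> w /=; rewrite Omega_path.
Qed.

Lemma coord_independent (s : seq source) (V : source -> set R) : uniq s ->
  (forall i, measurable (V i)) ->
  fine (P [set w | forall i, i \in s -> V i (coord i w)]) =
  \prod_(i <- s) fine (P (coord i @^-1` V i)).
Proof.
move=> us mV.
have [_ _ _ /(_ s (fun i => coord i @^-1` V i) us)] := queue.
rewrite (_ : \bigcap_(i in [set` s]) _ =
  [set w | forall i, i \in s -> V i (coord i w)])// => -> //.
  suff -> : (\prod_(i <- s) P (coord i @^-1` V i))%E =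
            (\prod_(i <- s) fine (P (coord i @^-1` V i)))%:E by [].
  elim: s {us} => [|i s IH]; first by rewrite !big_nil.
  by rewrite !big_cons IH EFinM -prob_EFin//; exact: mpre.
move=> [[k|k]|j] _ /=; [by exists (V (inl (inl k)))| |by exists (V (inr j))].
by exists [set m | V (inl (inr k)) m%:R].
Qed.

(** The sources [e] decide the event and its time, and [pi] avoids them. The two families of
    constraints therefore merge into one over the distinct sources [e ++ map pi s], to which mutual
    independence applies. *)
Lemma coord_independent_cat (e s : seq source) (pi pi' : source -> source)
    (W V : source -> set R) : cancel pi pi' ->
  (forall i j, i \in e -> pi j != i) -> uniq e -> uniq s ->
  (forall i, measurable (W i)) -> (forall i, measurable (V i)) ->
  fine (P ([set w | forall i, i \in e -> W i (coord i w)] `&`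
           [set w | forall i, i \in s -> V i (coord (pi i) w)])) =
  fine (P [set w | forall i, i \in e -> W i (coord i w)]) *
  \prod_(i <- s) fine (P (coord (pi i) @^-1` V i)).
Proof.
move=> piK pie ue us mW mV.
pose U j := if j \in e then W j else V (pi' j).
have mU j : measurable (U j) by rewrite /U; case: ifP.
have pi_notin j : pi j \notin e by apply/negP => /(pie _ j); rewrite eqxx.
rewrite (_ : _ `&` _ = [set w | forall i, i \in e ++ map pi s -> U i (coord i w)]).
  rewrite coord_independent//; last first.
    rewrite cat_uniq ue map_inj_uniq ?us ?andbT/=; last exact: can_inj piK.
    by apply/hasPn => _ /mapP[j _ ->].
  rewrite big_cat big_map/= coord_independent//; congr (_ * _).
    by apply: eq_big_seq => i ie; rewrite /U ie.
  by apply: eq_bigr => i _; rewrite /U (negbTE (pi_notin i)) piK.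
apply/seteqP; split=> w /=.
  move=> [H1 H2] i; rewrite mem_cat /U; case: ifPn => [ie _|ie /= /mapP[j js ->]].
    exact: H1.
  by rewrite piK; exact: H2.
move=> H; split=> i ie.
  by have := H i; rewrite mem_cat ie /U ie; exact.
have := H (pi i); rewrite mem_cat (map_f pi ie) orbT => /(_ isT).
by rewrite /U (negbTE (pi_notin i)) piK.
Qed.

(** [batch_law] speaks of sizes at least 1 only, but [q] already has total mass 1 there. *)
Lemma batch_law0 k : P (B k @^-1` [set 0%N]) = 0%E.
Proof.
have mB m : measurable (B k @^-1` [set m]) by exact: measurable_funPTI.
have : P (\bigcup_m (B k @^-1` [set m])) = 1%E.
  rewrite (_ : \bigcup_m _ = setT) ?probability_setT//.
  by apply/seteqP; split=> w // _; exists (B k w).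
rewrite measure_semi_bigcup//; last 2 first.
- by move=> i j _ _ [w [/= <- <-]].
- exact: bigcupT_measurable.
rewrite nneseries_recl// => PB.
have Pq : (\sum_(1 <= m <oo) P (B k @^-1` [set m]) = 1)%E.
  rewrite -q_law.2; apply: congr_lim; apply/funext => n.
  by apply: eq_big_nat => m /andP[m1 _]; rewrite (batch_law queue).
move: PB; rewrite Pq prob_EFin// => /(congr1 (fun z => z - 1)%E).
by rewrite addeK// subee// => ->.
Qed.

Lemma batch_law_eq k j (U : set nat) : P (B k @^-1` U) = P (B j @^-1` U).
Proof.
have E i : P (B i @^-1` U) = (\sum_(m <oo) P (B i @^-1` [set m] `&` B i @^-1` U))%E.
  rewrite -measure_semi_bigcup.
  - congr (P _); apply/seteqP; split=> w /=; first by exists (B i w).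
    by move=> [m _ []].
  - by move=> m; apply: measurableI; exact: measurable_funPTI.
  - by move=> m m' _ _ [w [[/= <- _] [<- _]]].
  - by apply: bigcupT_measurable => m; apply: measurableI; exact: measurable_funPTI.
rewrite !E; apply: eq_eseriesr => m _.
have [Um|Um] := pselect (U m).
  have F i : B i @^-1` [set m] `&` B i @^-1` U = B i @^-1` [set m].
    by apply/seteqP; split=> w /=; [case|move=> Bm; split; rewrite ?Bm].
  rewrite !F; case: m {Um F} => [|m]; first by rewrite !batch_law0.
  by rewrite !(batch_law queue).
have F i : B i @^-1` [set m] `&` B i @^-1` U = set0.
  by apply/seteqP; split=> w //= [Bm]; rewrite Bm.
by rewrite !F.
Qed.

Definition rate (i : source) : R := if i is inl (inl _) then rho else 1.

Lemma coord_tail i (a : R) : (forall k, i <> inl (inr k)) -> 0 <= a ->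
  fine (P [set w | a < coord i w]) = expR (- (rate i * a)).
Proof.
move=> iB a0; case: i iB => [[k|k]|j] //= iB.
- by apply: prob_exponential_tail => //; exact: interarrival_law queue k.
- by have := iB k.
- by apply: prob_exponential_tail => //; exact: service_law queue j.
Qed.

Definition same_kind (i j : source) : bool :=
  match i, j with
  | inl (inl _), inl (inl _) | inl (inr _), inl (inr _) | inr _, inr _ => true
  | _, _ => false
  end.

Lemma same_kind_law i j (V : set R) : same_kind i j -> measurable V ->
  P (coord i @^-1` V) = P (coord j @^-1` V).
Proof.
case: i => [[k|k]|k]; case: j => [[j|j]|j] //= _ mV.
- by rewrite !(interarrival_law queue).
- exact: (batch_law_eq k j [set m | V m%:R]).
- by rewrite !(service_law queue).
Qed.

(** The clocks still running after an event, in the new numbering: [a] tells whether the current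
    interarrival clock is among them, [K] counts the surviving jobs. *)
Definition affected (a : bool) (K : nat) : seq source :=
  nseq a (inl (inl 0%N)) ++ [seq inr j | j <- iota 0 K].

Definition speed (k : nat) (i : source) : R := if i is inr _ then k%:R^-1 else 1.

Lemma mem_affected a K i : (i \in affected a K) =
  match i with
  | inl (inl k) => a && (k == 0%N)
  | inl (inr k) => false
  | inr j => (j < K)%N
  end.
Proof.
rewrite mem_cat mem_nseq.
case: i => [[k|k]|j].
- rewrite (_ : inl (inl k) == _ = (k == 0%N))// [X in _ || X](_ : _ = false).
    by rewrite orbF; case: a.
  by apply/mapP => -[].
- by rewrite andbF/=; apply/mapP => -[].
- rewrite andbF/=; rewrite mem_map; last by move=> x y [].
  by rewrite mem_iota.
Qed.

Lemma uniq_affected a K : uniq (affected a K).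
Proof.
rewrite cat_uniq map_inj_uniq ?iota_uniq; last by move=> x y [].
rewrite andbT; apply/andP; split; first by case: a.
by apply/hasPn => _ /mapP[j _ ->]; case: a.
Qed.

Lemma sum_affected a K k :
  \sum_(i <- affected a K) rate i * speed k i = a%:R * rho + K%:R / k%:R.
Proof.
rewrite big_cat big_map/=; congr (_ + _).
  by case: a; rewrite ?big_nil ?mul0r//= big_cons big_nil mulr1 mul1r addr0.
rewrite (eq_bigr (fun=> k%:R^-1)); last by move=> j _; rewrite mul1r.
by rewrite big_const_seq count_predT size_iota iter_addr_0 -[LHS]mulr_natl.
Qed.

Section event_law.
Context (pi : source -> source) (a : bool) (K k : nat) (Q : set T) (tau : T -> R).
Hypothesis pi_kind : forall i, same_kind (pi i) i.
Hypothesis mQ : measurable Q.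
Hypothesis mtau : measurable_fun setT tau.
Hypothesis indep_window : forall (c e : R) (s : seq source) (V : source -> set R),
  c <= e -> uniq s -> (forall i, ray (V i)) ->
  fine (P (window Q tau c e `&`
     [set w | forall i, i \in s -> V i (coord (pi i) w)])) =
  fine (P (window Q tau c e)) * \prod_(i <- s) fine (P (coord (pi i) @^-1` V i)).

Let event h := race_won coord pi (affected a K) (speed k) Q tau h.
Let after w := residual coord pi (affected a K) (speed k) tau w.

Let speed_ge0 i : i \in affected a K -> 0 <= speed k i.
Proof. by case: i => [?|j] _ /=; rewrite ?invr_ge0. Qed.

Let rate_ge0 i : i \in affected a K -> 0 <= rate i.
Proof. by case: i => [[?|?]|j] _ //=; exact: ltW. Qed.

Let affected_tail i (v : R) : i \in affected a K -> 0 <= v ->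
  fine (P [set w | v < coord (pi i) w]) = expR (- (rate i * v)).
Proof.
rewrite mem_affected => iL v0.
rewrite (_ : rate i = rate (pi i)); last first.
  by have := pi_kind i; case: (i) (pi i) => [[?|?]|?] [[?|?]|?].
apply: coord_tail => // k' Ek'.
by have := pi_kind i; rewrite Ek'; case: i iL {Ek'} => [[?|?]|?].
Qed.

Let indep (s : seq source) (V : source -> set R) : uniq s ->
  (forall i, ray (V i)) ->
  fine (P [set w | forall i, i \in s -> V i (coord i w)]) =
  \prod_(i <- s) fine (P (coord i @^-1` V i)).
Proof. by move=> us rV; apply: coord_independent => // i; exact: measurable_ray. Qed.

Lemma measurable_event h : measurable (event h).
Proof. by apply: measurable_race_won => //; exact: measurable_coord. Qed.

Lemma event_law h n b y : 0 <= h ->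
  fine (P (event h `&` [set w | (y%:E < path_sojourn (after w) n b)%E])) =
  fine (P (event h)) * tail n b y.
Proof.
move=> h0; rewrite tailE.
apply: (@path_law_ext _ T R P source (event h) path after); last first.
- exact: path_measurable_longer.
- move=> C rC; apply: (@race_residual_cylinder _ _ _ P _ coord pi (affected a K)
    (speed k) rate Q tau) => //.
  + exact: measurable_coord.
  + exact: uniq_affected.
  + by move=> i V rV; apply: same_kind_law => //; exact: measurable_ray.
- by move=> i; apply: measurable_residual => //; exact: measurable_coord.
- exact: measurable_coord.
- exact: measurable_event.
Qed.

Lemma event_bounds h : 0 <= h ->
  fine (P (window Q tau 0 h)) * expR (- ((a%:R * rho + K%:R / k%:R) * h))
  <= fine (P (event h)) <= fine (P (window Q tau 0 h)).
Proof.
move=> h0; rewrite -sum_affected.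
apply: (@race_won_bounds _ _ _ P _ coord pi (affected a K) (speed k) rate Q tau) => //.
- exact: measurable_coord.
- exact: uniq_affected.
Qed.

End event_law.

End first_event.

(** * The three kinds of first event: none before [h], a completion, an arrival *)

Section one_step.
Context d (T : measurableType d) (R : realType) (P : probability T R).
Context (rho : R) (q : nat -> R) (A : nat -> {RV P >-> R})
  (B : nat -> {RV P >-> nat}) (S : nat -> {RV P >-> R}).
Hypothesis rho_gt0 : 0 < rho.
Hypothesis q_law : batch_size_law q.
Hypothesis queue : batch_queue_primitives rho q A B S.
Context (n b : nat).
Hypothesis b_gt0 : (0 < b)%N.

Let K := (b + n)%N.
Let K_gt0 : (0 : R) < K%:R. Proof. by rewrite ltr0n addn_gt0 b_gt0. Qed.
Let X : source -> T -> R := coord A B S.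
Let tl := tail A B S.
Let surviving (y : R) : set T := [set w | (y%:E < Omega A B S n b w)%E].
Let Lam := 1 + rho.

Let measurable_surviving y : measurable (surviving y).
Proof. exact: measurable_sojourn_longer. Qed.

Let measurable_X i : measurable_fun setT (X i).
Proof. exact: measurable_coord. Qed.

Let ray_mes (V : source -> set R) : (forall i, ray (V i)) -> forall i, measurable (V i).
Proof. by move=> rV i; exact: measurable_ray. Qed.

(** A race at the deterministic time [h]: for [h > 0] the window is the whole space, and the only
    constraint is that all clocks outlive [h]. *)
Definition quiet (h : R) : set T :=
  race_won X id (affected true K) (@speed R K) setT (fun=> h) h.

Let same_kind_refl i : same_kind i i. Proof. by case: i => [[]|]. Qed.

Let quiet_indep (h c e : R) (s : seq source) (V : source -> set R) :
  c <= e -> uniq s -> (forall i, ray (V i)) ->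
  fine (P (window setT (fun=> h) c e `&`
     [set w | forall i, i \in s -> V i (X (id i) w)])) =
  fine (P (window setT (fun=> h) c e)) *
  \prod_(i <- s) fine (P (X (id i) @^-1` V i)).
Proof.
move=> ce us rV; have [he|he] := boolP (c < h <= e).
  have -> : window setT (fun=> h) c e = [set: T] by apply/seteqP; split.
  rewrite setTI probability_setT mul1r; apply: (coord_independent queue us).
  exact: ray_mes.
have -> : window setT (fun=> h) c e = set0 :> set T.
  by apply/seteqP; split=> w //= [_]; rewrite (negbTE he).
by rewrite set0I measure0 mul0r.
Qed.

Lemma measurable_quiet h : measurable (quiet h).
Proof. exact: measurable_event. Qed.

Lemma quietP h w : quiet h w ->
  h < A 0%N w /\ forall j, (j < K)%N -> K%:R^-1 * h < S j w.
Proof.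
move=> [_ Hw]; split=> [|j jK].
  by have := Hw (inl (inl 0%N)); rewrite mem_affected /= mul1r; exact.
by have := Hw (inr j); rewrite mem_affected; exact.
Qed.

Lemma quiet_surviving (x h : R) : 0 < h ->
  fine (P (quiet h `&` surviving (x + h))) = fine (P (quiet h)) * tl n b x.
Proof.
move=> h0; rewrite -(@event_law _ _ _ _ _ _ _ _ _ rho_gt0 q_law queue id true K K
   setT (fun=> h) same_kind_refl measurableT (@measurable_cst _ _ _ _ _ _)
   (@quiet_indep h) h n b x (ltW h0)).
congr (fine (P (_ `&` _))); apply/seteqP; split=> w; rewrite /surviving /= /Omega
  (sojourn_quiet h) // addrK /path_sojourn /residual.
all: congr (_ < batch_sojourn _ _ _ _ _)%E; apply/funext => i.
all: rewrite mem_affected /= ?subr0 ?natrK//.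
all: by case: i => [|i] /=; rewrite ?mul1r.
Qed.

Lemma quiet_ge h : 0 < h -> expR (- (Lam * h)) <= fine (P (quiet h)).
Proof.
move=> h0; have := @event_bounds _ _ _ _ _ _ _ _ _ queue id true K K
   setT (fun=> h) same_kind_refl measurableT (@measurable_cst _ _ _ _ _ _)
   (@quiet_indep h) h (ltW h0).
have -> : window setT (fun=> h) 0 h = [set: T].
  by apply/seteqP; split=> // w _; split=> //; rewrite h0 lexx.
rewrite probability_setT mul1r divff ?gt_eqF// mul1r addrC.
by case/andP.
Qed.

Definition pi_completion (i : nat) (s : source) : source :=
  if s is inr j then inr (bump i j) else s.

(** [K.-1] jobs remain affected, but their speed is that of [K] jobs, since [K] were in service up
    to the event. Job [i] has the least requirement, so it leaves at time [K%:R * S i]. *)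
Definition completion (i : nat) (h : R) : set T :=
  race_won X (pi_completion i) (affected true K.-1) (@speed R K) setT
    (fun w => K%:R * S i w) h.

Let pi_completion_kind i s : same_kind (pi_completion i s) s.
Proof. by case: s => [[]|]. Qed.

Let window_completion i c e : window setT (fun w => K%:R * S i w) c e =
  [set w | forall s, s \in [:: inr i] -> `]c / K%:R, e / K%:R]%classic (X s w)].
Proof.
apply/seteqP; split=> w /=.
  move=> [_ /andP[h1 h2]] s; rewrite mem_seq1 => /eqP -> /=.
  by rewrite in_itv/= ltr_pdivrMr// ler_pdivlMr// mulrC h1 h2.
move=> /(_ (inr i)); rewrite mem_head => /(_ isT) /=.
by rewrite in_itv/= ltr_pdivrMr// ler_pdivlMr// mulrC.
Qed.

Let completion_indep i (c e : R) (s : seq source) (V : source -> set R) :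
  c <= e -> uniq s -> (forall i, ray (V i)) ->
  fine (P (window setT (fun w => K%:R * S i w) c e `&`
     [set w | forall j, j \in s -> V j (X (pi_completion i j) w)])) =
  fine (P (window setT (fun w => K%:R * S i w) c e)) *
  \prod_(j <- s) fine (P (X (pi_completion i j) @^-1` V j)).
Proof.
move=> ce us rV; rewrite window_completion.
apply: (@coord_independent_cat _ _ _ _ _ _ _ _ _ queue _ _ _
  (fun s => if s is inr j then inr (unbump i j) else s)
  (fun=> `]c / K%:R, e / K%:R]%classic)) => //.
- by case=> [//|j] /=; rewrite bumpK.
- move=> s' j; rewrite mem_seq1 => /eqP ->; case: j => [//|j] /=.
  by apply/eqP => -[/eqP]; rewrite eq_sym (negbTE (neq_bump _ _)).
- exact: ray_mes.
Qed.

Let measurable_completion_delay i : measurable_fun setT (fun w => K%:R * S i w).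
Proof. exact: measurable_funM. Qed.

Lemma measurable_completion i h : measurable (completion i h).
Proof. by apply: measurable_event. Qed.

(* The sojourn remaining after the event has to exceed [x + h - t], which lies
   between [x] and [x + h]. *)
Let sandwich (G : set T) (t : T -> R) (W : T -> \bar R) n' b' (x h : R) :
    measurable G ->
    (forall y, measurable [set w | (y%:E < W w)%E]) ->
    (forall y, fine (P (G `&` [set w | (y%:E < W w)%E])) = fine (P G) * tl n' b' y) ->
    (forall w, G w -> 0 < t w <= h) ->
    (forall w, G w -> forall y : R, (y%:E < Omega A B S n b w)%E = ((y - t w)%:E < W w)%E) ->
  fine (P G) * tl n' b' (x + h) <= fine (P (G `&` surviving (x + h)))
    <= fine (P G) * tl n' b' x.
Proof.
move=> mG mW PW tG HG; rewrite -!PW; apply/andP; split; apply: prob_fine_le.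
- exact: measurableI.
- exact: measurableI.
- move=> w [Gw Ww]; split=> //; rewrite /surviving /= HG//; apply: le_lt_trans Ww.
  by rewrite lee_fin gerBl; case/andP: (tG w Gw) => /ltW.
- exact: measurableI.
- exact: measurableI.
- move=> w [Gw]; rewrite /surviving /= HG// => Ww; split=> //=; apply: le_lt_trans Ww.
  by rewrite lee_fin -addrA lerDl subr_ge0; case/andP: (tG w Gw).
Qed.

Lemma completionP i h w : (i < K)%N -> completion i h w ->
  [/\ 0 < K%:R * S i w <= h, K%:R * S i w < A 0%N w &
      forall j, (j < K)%N -> j != i -> S i w < S j w].
Proof.
move=> iK [[_ th] Hw]; split=> //.
  by have := Hw (inl (inl 0%N)); rewrite mem_affected /= mul1r; exact.
move=> j jK ji.
have ij : bump i (unbump i j) = j by apply: unbumpK; rewrite inE.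
have := Hw (inr (unbump i j)); rewrite mem_affected /= ij mulKf ?gt_eqF//; apply.
exact: ltn_unbump.
Qed.

Lemma completion_surviving i (x h : R) : (i < K)%N -> 0 <= h ->
  fine (P (completion i h)) * tl (n - (b <= i)) (b - (i < b)) (x + h)
    <= fine (P (completion i h `&` surviving (x + h)))
    <= fine (P (completion i h)) * tl (n - (b <= i)) (b - (i < b)) x.
Proof.
move=> iK h0.
pose after w := residual X (pi_completion i) (affected true K.-1) (@speed R K)
  (fun w => K%:R * S i w) w.
apply: (@sandwich _ (fun w => K%:R * S i w)
  (fun w => path_sojourn (after w) (n - (b <= i)) (b - (i < b)))).
- exact: measurable_completion.
- move=> y; rewrite (_ : mkset _ = after @^-1` longer (n - (b <= i)) (b - (i < b)) y)//.
  apply: path_measurable_preimage; last exact: path_measurable_longer.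
  by move=> s; apply: measurable_residual.
- move=> y; apply: (@event_law _ _ _ _ _ _ _ _ _ rho_gt0 q_law queue
    (pi_completion i) true K.-1 K) => //.
  exact: completion_indep.
- by move=> w [[_]].
move=> w /(completionP iK)[/andP[t0 th] HA HS] y.
rewrite /Omega (@sojourn_completion R _ _ _ n b i)//.
rewrite /path_sojourn /after /residual.
congr (_ < batch_sojourn _ _ _ _ _)%E; apply/funext => j.
- by rewrite mem_affected /=; case: j => [|j] /=; rewrite ?mul1r.
- by rewrite mem_affected /= subr0 natrK.
- by rewrite mem_affected.
Qed.

Let coord_window i (v : R) : (forall k, i <> inl (inr k)) -> 0 <= v ->
  fine (P [set w | 0 < X i w <= v]) = 1 - expR (- (rate rho i * v)).
Proof.
move=> iB v0.
have m1 := measurable_lt_set (@measurable_cst _ _ T R setT 0) (measurable_X i).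
have m2 := measurable_lt_set (@measurable_cst _ _ T R setT v) (measurable_X i).
rewrite -(coord_tail queue iB v0).
have <- : fine (P [set w | 0 < X i w]) = 1.
  by rewrite (coord_tail queue)// mulr0 oppr0 expR0.
rewrite (_ : [set w | 0 < X i w <= v] =
   [set w | 0 < X i w] `\` [set w | v < X i w]); last first.
  apply/seteqP; split=> w /=.
    by move=> /andP[-> Xv]; split=> //; apply/negP; rewrite -leNgt.
  by move=> [-> /negP]; rewrite -leNgt.
rewrite measureD//; last by rewrite -ge0_fin_numE// fin_num_measure.
rewrite fineB ?fin_num_measure//; last exact: measurableI.
congr (_ - fine (P _)); apply/seteqP; split=> w /=; first by case.
by move=> vX; split=> //; exact: le_lt_trans vX.
Qed.

Lemma completion_bounds i h : (i < K)%N -> 0 <= h ->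
  (1 - expR (- (h / K%:R))) * expR (- (Lam * h)) <= fine (P (completion i h))
    <= 1 - expR (- (h / K%:R)).
Proof.
move=> iK h0.
have hK : 0 <= h / K%:R by rewrite divr_ge0// ltW.
have := event_bounds queue true K.-1 K (pi_completion_kind i) measurableT
   (measurable_completion_delay i) (@completion_indep i) h0.
have -> : fine (P (window setT (fun w => K%:R * S i w) 0 h)) = 1 - expR (- (h / K%:R)).
  rewrite (_ : window _ _ _ _ = [set w | 0 < X (inr i) w <= h / K%:R]).
    by rewrite coord_window// mul1r.
  apply/seteqP; split=> w; rewrite /window /= ler_pdivlMr// (mulrC (S i w))
    pmulr_rgt0//; by case.
move=> /andP[h1 ->]; rewrite andbT; apply: le_trans h1.
apply: ler_wpM2l; first by rewrite subr_ge0 -[leRHS]expR0 ler_expR oppr_le0.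
(* Here the decay rate is rho + (K - 1) / K, at most [Lam]. *)
rewrite ler_expR lerN2 ler_wpM2r// mul1r addrC lerD2r.
by rewrite ler_pdivrMr// mul1r ler_nat leq_pred.
Qed.

Definition pi_arrival (s : source) : source :=
  match s with
  | inl (inl k) => inl (inl k.+1)
  | inl (inr k) => inl (inr k.+1)
  | inr j => inr j
  end.

(** The interarrival clock is the one that rings, hence [affected false K]; [pi_arrival] drops it
    together with the size of the batch it brings. *)
Definition arrival (m : nat) (h : R) : set T :=
  race_won X pi_arrival (affected false K) (@speed R K) (B 0%N @^-1` [set m])
    (A 0%N) h.

Let pi_arrival_kind s : same_kind (pi_arrival s) s.
Proof. by case: s => [[]|]. Qed.

Let arrival_box (m : nat) (c e : R) (s : source) : set R :=
  if s is inl (inr _) then [set m%:R] else `]c, e]%classic.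

Let window_arrival m c e : window (B 0%N @^-1` [set m]) (A 0%N) c e =
  [set w | forall s, s \in [:: inl (inl 0%N); inl (inr 0%N)] ->
     arrival_box m c e s (X s w)].
Proof.
apply/seteqP; split=> w /=.
  move=> [Bm /andP[h1 h2]] s; rewrite !inE => /orP[] /eqP -> /=.
    by rewrite in_itv/= h1 h2.
  by rewrite Bm.
move=> H; split.
  have := H (inl (inr 0%N)); rewrite !inE eqxx orbT => /(_ isT) /= /eqP.
  by rewrite eqr_nat => /eqP.
by have := H (inl (inl 0%N)); rewrite !inE eqxx => /(_ isT) /=; rewrite in_itv.
Qed.

Let measurable_arrival_box m c e s : measurable (arrival_box m c e s).
Proof. by case: s => [[]|] * /=. Qed.

Let arrival_indep m (c e : R) (s : seq source) (V : source -> set R) :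
  c <= e -> uniq s -> (forall i, ray (V i)) ->
  fine (P (window (B 0%N @^-1` [set m]) (A 0%N) c e `&`
     [set w | forall j, j \in s -> V j (X (pi_arrival j) w)])) =
  fine (P (window (B 0%N @^-1` [set m]) (A 0%N) c e)) *
  \prod_(j <- s) fine (P (X (pi_arrival j) @^-1` V j)).
Proof.
move=> ce us rV; rewrite window_arrival.
apply: (@coord_independent_cat _ _ _ _ _ _ _ _ _ queue _ _ _
  (fun s => match s with
     | inl (inl k) => inl (inl k.-1) | inl (inr k) => inl (inr k.-1)
     | inr j => inr j end) (arrival_box m c e)) => //.
- by case=> [[]|].
- by move=> s' j; rewrite !inE => /orP[] /eqP ->; case: j => [[]|].
- exact: ray_mes.
Qed.

Let measurable_batch m : measurable (B 0%N @^-1` [set m]).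
Proof. exact: measurable_funPTI. Qed.

Lemma measurable_arrival m h : measurable (arrival m h).
Proof. by apply: measurable_event. Qed.

Lemma arrivalP m h w : arrival m h w ->
  [/\ B 0%N w = m, 0 < A 0%N w <= h &
      forall j, (j < K)%N -> K%:R^-1 * A 0%N w < S j w].
Proof.
move=> [[Bm th] Hw]; split=> // j jK.
by have := Hw (inr j); rewrite mem_affected; exact.
Qed.

Lemma arrival_surviving m (x h : R) : 0 <= h ->
  fine (P (arrival m h)) * tl (n + m) b (x + h)
    <= fine (P (arrival m h `&` surviving (x + h)))
    <= fine (P (arrival m h)) * tl (n + m) b x.
Proof.
move=> h0.
pose after w := residual X pi_arrival (affected false K) (@speed R K) (A 0%N) w.
apply: (@sandwich _ (A 0%N) (fun w => path_sojourn (after w) (n + m) b)).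
- exact: measurable_arrival.
- move=> y; rewrite (_ : mkset _ = after @^-1` longer (n + m) b y)//.
  apply: path_measurable_preimage; last exact: path_measurable_longer.
  by move=> s; apply: measurable_residual.
- move=> y; apply: (@event_law _ _ _ _ _ _ _ _ _ rho_gt0 q_law queue
    pi_arrival false K K) => //.
  exact: arrival_indep.
- by move=> w [[_]].
move=> w /arrivalP[Bm /andP[t0 th] HS] y; rewrite /Omega sojourn_arrival//.
rewrite /path_sojourn /after /residual Bm.
congr (_ < batch_sojourn _ _ _ _ _)%E; apply/funext => j.
- by rewrite mem_affected /= subr0.
- by rewrite mem_affected /= subr0 natrK.
- by rewrite mem_affected.
Qed.

Lemma prob_batch m : fine (P (B 0%N @^-1` [set m])) = if m is 0%N then 0 else q m.
Proof.
case: m => [|m]; first by rewrite (batch_law0 q_law queue).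
by rewrite (batch_law queue).
Qed.

Lemma arrival_bounds m h : 0 <= h ->
  (if m is 0%N then 0 else q m) * (1 - expR (- (rho * h))) * expR (- (Lam * h))
    <= fine (P (arrival m h))
    <= (if m is 0%N then 0 else q m) * (1 - expR (- (rho * h))).
Proof.
move=> h0.
have := event_bounds queue false K K pi_arrival_kind (measurable_batch m)
   (measurable_coord A B S (inl (inl 0%N))) (@arrival_indep m) h0.
have -> : fine (P (window (B 0%N @^-1` [set m]) (A 0%N) 0 h)) =
    (if m is 0%N then 0 else q m) * (1 - expR (- (rho * h))).
  rewrite window_arrival (coord_independent queue)//.
  rewrite big_cons big_seq1 mulrC -prob_batch -(@coord_window (inl (inl 0%N)))//.
  congr (fine (P _) * fine (P _)); apply/seteqP; split=> w /=.
    by move=> /eqP; rewrite eqr_nat => /eqP.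
  by move=> ->.
move=> /andP[h1 ->]; rewrite andbT; apply: le_trans h1.
apply: ler_wpM2l.
  rewrite mulr_ge0//; first by rewrite -prob_batch prob_fine_ge0.
  by rewrite subr_ge0 -[leRHS]expR0 ler_expR oppr_le0 mulr_ge0// ltW.
by rewrite mul0r add0r divff ?gt_eqF// ler_expR lerN2 ler_wpM2r// lerDl ltW.
Qed.

Lemma quiet_completion i h : (i < K)%N -> quiet h `&` completion i h = set0.
Proof.
move=> iK; apply/seteqP; split=> w // -[/quietP[_ /(_ i iK)] +].
move=> + /(completionP iK)[/andP[_ Sh] _ _].
by rewrite ltr_pdivrMl// ltNge Sh.
Qed.

Lemma quiet_arrival m h : quiet h `&` arrival m h = set0.
Proof.
apply/seteqP; split=> w // -[/quietP[hA _] /arrivalP[_ /andP[_ Ah] _]].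
by rewrite ltNge Ah in hA.
Qed.

Lemma completion_completion i j h : (i < K)%N -> (j < K)%N -> i != j ->
  completion i h `&` completion j h = set0.
Proof.
move=> iK jK ij; apply/seteqP; split=> w //.
move=> -[/(completionP iK)[_ _ Hi] /(completionP jK)[_ _ Hj]].
have := Hi j jK; rewrite eq_sym => /(_ ij) ltij.
by have := lt_trans ltij (Hj i iK ij); rewrite ltxx.
Qed.

Lemma completion_arrival i m h : (i < K)%N ->
  completion i h `&` arrival m h = set0.
Proof.
move=> iK; apply/seteqP; split=> w //.
move=> -[/(completionP iK)[_ SA _] /arrivalP[_ _ /(_ i iK)]].
by rewrite ltr_pdivrMl// ltNge (ltW SA).
Qed.

Lemma trivIset_arrival h : trivIset setT (arrival ^~ h).
Proof.
by move=> i j _ _ [w [/arrivalP[<- _ _] /arrivalP[<- _ _]]].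
Qed.

End one_step.

(** * Monotonicity and Lipschitz bounds *)

Section increments.
Context d (T : measurableType d) (R : realType) (P : probability T R).
Context (rho : R) (q : nat -> R) (A : nat -> {RV P >-> R})
  (B : nat -> {RV P >-> nat}) (S : nat -> {RV P >-> R}).
Hypothesis rho_gt0 : 0 < rho.
Hypothesis q_law : batch_size_law q.
Hypothesis queue : batch_queue_primitives rho q A B S.
Let tl := tail A B S.
Let Lam := 1 + rho.

Lemma tail_ge0 n b y : 0 <= tl n b y.
Proof. exact: prob_fine_ge0. Qed.

Lemma tail_le1 n b y : tl n b y <= 1.
Proof. by apply: prob_fine_le1; exact: measurable_sojourn_longer. Qed.

Lemma tail_nincr n b y z : y <= z -> tl n b z <= tl n b y.
Proof.
move=> yz; apply: prob_fine_le; do ?exact: measurable_sojourn_longer.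
by move=> w; apply: le_lt_trans; rewrite lee_fin.
Qed.

(** With no tagged job the initial state is already completed, at clock 0. This reproduces the
    convention for b < 1 at nonnegative times. *)
Lemma tail_empty_batch n y : 0 <= y -> tl n 0 y = 0.
Proof.
move=> y0; rewrite /tl /tail (_ : mkset _ = set0) ?measure0//.
apply/seteqP; split=> w //; rewrite /= ltNge => /negP; apply.
apply: (@le_trans _ _ 0%E); last by rewrite lee_fin.
apply: ereal_inf_lbound; exists 0%N => //=.
by rewrite /batch_completed /= /new_jobs; elim: (iota _ _).
Qed.

Let Lam_gt0 : 0 < Lam. Proof. by rewrite addr_gt0. Qed.

(** A batch that would outlive [y] after a quiet period of length [h] outlives [y + h], so E(y + h)
    >= P(quiet) E(y), with P(quiet) >= 1 - Lam h and E <= 1. *)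
Lemma tail_lipschitz n b (y h : R) : 0 <= y -> 0 <= h ->
  tl n b y - Lam * h <= tl n b (y + h) <= tl n b y.
Proof.
move=> y0; rewrite le_eqVlt => /predU1P[<-|h0]; first by rewrite mulr0 subr0 addr0 lexx.
apply/andP; split; last by apply: tail_nincr; rewrite lerDl ltW.
case: b => [|b].
  by rewrite !tail_empty_batch ?addr_ge0 ?(ltW h0)// sub0r oppr_le0 mulr_ge0 ?ltW.
have mq := measurable_quiet A B S n b.+1 h.
have ms := measurable_sojourn_longer A B S n b.+1 (y + h).
have := @prob_fine_le _ _ _ P _ _ (measurableI _ _ mq ms) ms (@subIsetr _ _ _).
rewrite (quiet_surviving rho_gt0 q_law queue n (ltn0Sn b) y h0).
apply: le_trans; rewrite -/tl.
have t0 := tail_ge0 n b.+1 y; have t1 := tail_le1 n b.+1 y.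
have Lh : 0 <= Lam * h by rewrite mulr_ge0// ltW.
have pq : 1 - Lam * h <= fine (P (quiet A B S n b.+1 h)).
  apply: le_trans (quiet_ge queue n (ltn0Sn b) h0).
  exact: expR_ge1Dx.
apply: le_trans (ler_wpM2r t0 pq); nra.
Qed.

Let batch_weight (m : nat) : R := if m is 0%N then 0 else q m.

(** The sum starts at [m = 0] with weight 0, to match the countable union of all arrival events, and
    is taken in the extended reals, where it needs no convergence proof; [arrival_mean_series]
    returns to the real series. *)
Definition arrival_mean (n b : nat) (y : R) : R :=
  fine (\sum_(m <oo) (batch_weight m * tl (n + m) b y)%:E)%E.

Lemma batch_weight_ge0 m : 0 <= batch_weight m.
Proof. by case: m => [|m] //=; exact: q_law.1. Qed.

Lemma sum_batch_weight : (\sum_(m <oo) (batch_weight m)%:E = 1)%E.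
Proof.
rewrite nneseries_recl//; last by move=> m _; rewrite lee_fin batch_weight_ge0.
rewrite add0e -q_law.2; apply: congr_lim; apply/funext => k.
by apply: eq_big_nat => -[].
Qed.

Let weighted_ge0 n b y m : (0 <= (batch_weight m * tl (n + m) b y)%:E)%E.
Proof. by rewrite lee_fin mulr_ge0 ?batch_weight_ge0 ?tail_ge0. Qed.

Lemma arrival_meanE n b y :
  (\sum_(m <oo) (batch_weight m * tl (n + m) b y)%:E)%E = (arrival_mean n b y)%:E.
Proof.
rewrite fineK// ge0_fin_numE; last exact: nneseries_ge0.
apply: (@le_lt_trans _ _ 1%E); last exact: ltry.
rewrite -sum_batch_weight; apply: lee_nneseries => // m _.
by rewrite lee_fin ler_piMr ?batch_weight_ge0 ?tail_le1.
Qed.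

Lemma arrival_mean_lipschitz n b (y h : R) : 0 <= y -> 0 <= h ->
  arrival_mean n b y - Lam * h <= arrival_mean n b (y + h) <= arrival_mean n b y.
Proof.
move=> y0 h0; rewrite lerBlDr -!lee_fin EFinD -!arrival_meanE; apply/andP; split.
  have -> : (Lam * h)%:E = (\sum_(m <oo) (Lam * h)%:E * (batch_weight m)%:E)%E.
    by rewrite nneseriesZl ?sum_batch_weight ?mule1// => m _; rewrite lee_fin batch_weight_ge0.
  rewrite -nneseriesD//; last first.
    by move=> m _ _; rewrite -EFinM lee_fin !mulr_ge0 ?batch_weight_ge0// ltW.
  apply: lee_nneseries => // m _; rewrite -EFinM -EFinD lee_fin (mulrC (Lam * h)) -mulrDr.
  apply: ler_wpM2l; first exact: batch_weight_ge0.
  by have /andP[+ _] := tail_lipschitz (n + m) b y0 h0; rewrite lerBlDr.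
apply: lee_nneseries => // m _; rewrite lee_fin; apply: ler_wpM2l.
  exact: batch_weight_ge0.
by have /andP[] := tail_lipschitz (n + m) b y0 h0.
Qed.

End increments.

(** Total probability over disjoint parts that need not be known to cover the space: the upper bound
    pays for the missing mass. *)
Lemma prob_three_parts d (T : measurableType d) (R : realType)
    (P : probability T R) (D U V W : set T) :
    measurable D -> measurable U -> measurable V -> measurable W ->
    U `&` V = set0 -> U `&` W = set0 -> V `&` W = set0 ->
  fine (P (D `&` U)) + fine (P (D `&` V)) + fine (P (D `&` W)) <= fine (P D) <=
  fine (P (D `&` U)) + fine (P (D `&` V)) + fine (P (D `&` W)) +
    (1 - (fine (P U) + fine (P V) + fine (P W))).
Proof.
move=> mD mU mV mW UV UW VW.
have UVW : (U `|` V) `&` W = set0 by rewrite setIUl UW VW setU0.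
have parts E : measurable E -> fine (P (E `&` (U `|` V `|` W))) =
    fine (P (E `&` U)) + fine (P (E `&` V)) + fine (P (E `&` W)).
  move=> mE; rewrite !setIUr prob_fineU.
  - rewrite prob_fineU//; [exact: measurableI|exact: measurableI|].
    by rewrite setIACA UV setI0.
  - by apply: measurableU; exact: measurableI.
  - exact: measurableI.
  - by rewrite -setIUr setIACA UVW setI0.
have mZ : measurable (U `|` V `|` W) by do 2 apply: measurableU => //.
have Z1 := parts _ (@measurableT _ T); rewrite !setTI in Z1.
rewrite -(parts _ mD) -Z1; apply/andP; split.
  by apply: prob_fine_le => //; exact: measurableI.
have mC := measurableC mZ.
have -> : 1 - fine (P (U `|` V `|` W)) = fine (P (~` (U `|` V `|` W))).
  by rewrite probability_setC// fineB ?fin_num_measure.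
rewrite -prob_fineU//; last 2 first.
- exact: measurableI.
- by rewrite -setIA setICr setI0.
apply: prob_fine_le => //; first by apply: measurableU => //; exact: measurableI.
move=> w Dw; have [Zw|Zw] := pselect ((U `|` V `|` W) w); [left|right] => //.
Qed.

Section expansion.
Context (R : realType).

(** The lower bound comes from (1 + u) exp(-u) <= 1, that is from 1 + u <= exp(u). *)
Lemma expRN_bounds (u : R) : 0 <= u -> u * (1 - u) <= 1 - expR (- u) <= u.
Proof.
move=> u0; have h1 := expR_ge1Dx (- u); have h2 := expR_ge1Dx u.
have e0 := expR_ge0 (- u).
have : expR u * expR (- u) = 1 by rewrite -expRD subrr expR0.
move: (expR u) (expR (- u)) h1 h2 e0 => a e h1 h2 e0 ae.
apply/andP; split; last by lra.
have : (1 + u) * e <= 1 by rewrite -[leRHS]ae ler_wpM2r.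
have : 0 <= u * u by rewrite mulr_ge0.
nra.
Qed.

(** The product is at least u (1 - u) (1 - l) >= u (1 - l)^2 >= u (1 - 2 l). *)
Lemma expRN_product_ge (u l : R) : 0 <= u -> u <= l -> 2 * l <= 1 ->
  u * (1 - 2 * l) <= (1 - expR (- u)) * expR (- l).
Proof.
move=> u0 ul l1; have /andP[h1 _] := expRN_bounds u0.
have h2 := expR_ge1Dx (- l).
apply: (@le_trans _ _ (u * (1 - l) * (1 - l))).
  by rewrite -mulrA ler_wpM2l//; nra.
apply: ler_pM; [nra|lra| |lra].
by apply: le_trans h1; rewrite ler_wpM2l//; lra.
Qed.

End expansion.

(** * First-order expansion of the tail *)

Section estimate.
Context d (T : measurableType d) (R : realType) (P : probability T R).
Context (rho : R) (q : nat -> R) (A : nat -> {RV P >-> R})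
  (B : nat -> {RV P >-> nat}) (S : nat -> {RV P >-> R}).
Hypothesis rho_gt0 : 0 < rho.
Hypothesis q_law : batch_size_law q.
Hypothesis queue : batch_queue_primitives rho q A B S.
Let tl := tail A B S.
Let Lam := 1 + rho.

(** The right-hand side of the system, with natural indices: at [n = 0] the term in [n.-1] has
    coefficient 0, and at [b = 1] the last term is the tail of an empty batch. *)
Definition drift (n b : nat) (y : R) : R :=
  rho * arrival_mean q A B S n b y - (1 + rho) * tl n b y
  + n%:R / (n + b)%:R * tl n.-1 b y + b%:R / (n + b)%:R * tl n b.-1 y.

Context (n b : nat).
Hypothesis b_gt0 : (0 < b)%N.
Let K := (b + n)%N.
Let surviving (y : R) : set T := [set w | (y%:E < Omega A B S n b w)%E].
Let quiet_ := quiet A B S n b.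
Let completion_ := completion A B S n b.
Let arrival_ := arrival A B S n b.
Let weight (m : nat) : R := if m is 0%N then 0 else q m.

Let K_gt0 : (0 : R) < K%:R. Proof. by rewrite ltr0n addn_gt0 b_gt0. Qed.

Let Lam_gt0 : 0 < Lam. Proof. by rewrite addr_gt0. Qed.

Let completions (h : R) : set T := \big[setU/set0]_(i < K) completion_ i h.
Let arrivals (h : R) : set T := \bigcup_m arrival_ m h.

Let measurable_completions h : measurable (completions h).
Proof. by apply: bigsetU_measurable => i _; exact: measurable_completion. Qed.

Let measurable_arrivals h : measurable (arrivals h).
Proof. by apply: bigcupT_measurable => m; exact: measurable_arrival. Qed.

Let prob_completions (D : set T) h : measurable D ->
  fine (P (D `&` completions h)) = \sum_(i < K) fine (P (D `&` completion_ i h)).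
Proof.
move=> mD.
(* Padding by [set0] turns the [K] disjoint events into a disjoint sequence indexed by all of
   [nat]. *)
pose F i := if (i < K)%N then D `&` completion_ i h else set0.
have mF i : measurable (F i).
  by rewrite /F; case: ifP => // _; apply: measurableI => //; exact: measurable_completion.
have tF : trivIset setT F.
  move=> i j _ _ [w []]; rewrite /F; case: ifP => // iK; case: ifP => // jK.
  move=> [_ wi] [_ wj]; apply/eqP; apply: contraPT I => ij _.
  have := completion_completion A B S b_gt0 h iK jK ij.
  by move=> /seteqP[/(_ w) + _] => /(_ (conj wi wj)).
have -> : D `&` completions h = \big[setU/set0]_(i < K) F i.
  rewrite /completions big_distrr /=; apply: eq_bigr => i _.
  by rewrite /F ltn_ord.
rewrite measure_bigsetU//.
rewrite (eq_bigr (fun i : 'I_K => (fine (P (D `&` completion_ i h)))%:E)); last first.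
  move=> i _; rewrite /F ltn_ord; apply: prob_EFin.
  by apply: measurableI => //; exact: measurable_completion.
by rewrite sumEFin.
Qed.

Let prob_arrivals (D : set T) h : measurable D ->
  P (D `&` arrivals h) = (\sum_(m <oo) P (D `&` arrival_ m h))%E.
Proof.
move=> mD; have mF m : measurable (D `&` arrival_ m h).
  by apply: measurableI => //; exact: measurable_arrival.
have tF : trivIset setT (fun m => D `&` arrival_ m h).
  move=> i j _ _ [w [[_ wi] [_ wj]]].
  exact: (@trivIset_arrival _ _ _ _ A B S n b h i j I I (ex_intro _ w (conj wi wj))).
by rewrite setI_bigcupr measure_semi_bigcup//; exact: bigcupT_measurable.
Qed.

Let disjoint_qc h : quiet_ h `&` completions h = set0.
Proof.
rewrite big_distrr /=; apply: big1 => i _.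
exact: (quiet_completion A B S b_gt0).
Qed.

Let disjoint_qa h : quiet_ h `&` arrivals h = set0.
Proof.
rewrite setI_bigcupr; apply/seteqP; split=> // w [m _].
by rewrite quiet_arrival.
Qed.

Let disjoint_ca h : completions h `&` arrivals h = set0.
Proof.
rewrite big_distrl /=; apply: big1 => i _.
rewrite setI_bigcupr; apply/seteqP; split=> // w [m _].
by rewrite (completion_arrival A B S b_gt0).
Qed.

Let completion_prob i h : (i < K)%N -> 0 <= h -> 2 * (Lam * h) <= 1 ->
  h / K%:R * (1 - 2 * (Lam * h)) <= fine (P (completion_ i h)) <= h / K%:R.
Proof.
move=> iK h0 h1; have hK : 0 <= h / K%:R by rewrite divr_ge0// ltW.
have /andP[p1 p2] := completion_bounds queue b_gt0 iK h0.
have /andP[_ e2] := expRN_bounds hK.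
rewrite (le_trans p2 e2) andbT; apply: le_trans p1.
apply: expRN_product_ge => //; rewrite ler_pdivrMr//.
have k1 : (1 : R) <= K%:R by rewrite ler1n addn_gt0 b_gt0.
have r0 : 0 <= rho * h by rewrite mulr_ge0// ltW.
rewrite /Lam mulrDl mul1r; nra.
Qed.

Let arrival_prob m h : 0 <= h -> 2 * (Lam * h) <= 1 ->
  weight m * (rho * h) * (1 - 2 * (Lam * h)) <= fine (P (arrival_ m h))
  <= weight m * (rho * h).
Proof.
move=> h0 h1; have rh : 0 <= rho * h by rewrite mulr_ge0// ltW.
have w0 : 0 <= weight m by exact: batch_weight_ge0.
have /andP[p1 p2] := arrival_bounds rho_gt0 q_law queue n b_gt0 m h0.
have /andP[_ e2] := expRN_bounds rh.
apply/andP; split; last by apply: le_trans p2 _; rewrite ler_wpM2l.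
apply: le_trans p1; rewrite -!mulrA ler_wpM2l// mulrA; apply: expRN_product_ge => //.
by rewrite /Lam mulrDl mul1r lerDr.
Qed.

Let next_tail (i : nat) (y : R) : R := tl (n - (b <= i)) (b - (i < b)) y.

(** Of the loss 3 Lam h, two parts come from the probability of the event ([completion_prob]) and
    one from replacing x + h by x ([tail_lipschitz]). *)
Let completion_term i (x h : R) : (i < K)%N -> 0 <= x -> 0 <= h ->
    2 * (Lam * h) <= 1 ->
  h / K%:R * (next_tail i x - 3 * (Lam * h))
    <= fine (P (surviving (x + h) `&` completion_ i h)) <= h / K%:R * next_tail i x.
Proof.
move=> iK x0 h0 h1; rewrite setIC.
have /andP[p1 p2] := completion_prob iK h0 h1.
have /andP[s1 s2] := completion_surviving rho_gt0 q_law queue b_gt0 x iK h0.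
have /andP[l1 _] := tail_lipschitz rho_gt0 q_law queue
  (n - (b <= i)) (b - (i < b)) x0 h0.
have t0 := tail_ge0 A B S (n - (b <= i)) (b - (i < b)) (x + h).
have t1 := tail_le1 A B S (n - (b <= i)) (b - (i < b)) (x + h).
have t0' := tail_ge0 A B S (n - (b <= i)) (b - (i < b)) x.
have hK : 0 <= h / K%:R by rewrite divr_ge0// ltW.
have Lh : 0 <= Lam * h by rewrite mulr_ge0// ltW.
apply/andP; split.
  apply: le_trans s1; apply: le_trans (ler_wpM2r t0 p1).
  rewrite -[leRHS]mulrA ler_wpM2l// /next_tail.
  move: l1 t0 t1 Lh; rewrite -/tl -/Lam; nra.
by apply: le_trans s2 _; exact: ler_wpM2r.
Qed.

Let arrival_term m (x h : R) : 0 <= x -> 0 <= h -> 2 * (Lam * h) <= 1 ->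
  rho * h * (weight m * tl (n + m) b x) - 3 * (rho * h * (Lam * h)) * weight m
    <= fine (P (surviving (x + h) `&` arrival_ m h))
    <= rho * h * (weight m * tl (n + m) b x).
Proof.
move=> x0 h0 h1; rewrite setIC.
have /andP[p1 p2] := arrival_prob m h0 h1.
have /andP[s1 s2] := arrival_surviving rho_gt0 q_law queue n b_gt0 m x h0.
have /andP[l1 _] := tail_lipschitz rho_gt0 q_law queue (n + m) b x0 h0.
have t0 := tail_ge0 A B S (n + m) b (x + h).
have t1 := tail_le1 A B S (n + m) b (x + h).
have t0' := tail_ge0 A B S (n + m) b x.
have w0 : 0 <= weight m by exact: batch_weight_ge0.
have wr : 0 <= weight m * (rho * h) by rewrite !mulr_ge0// ltW.
have Lh : 0 <= Lam * h by rewrite mulr_ge0// ltW.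
apply/andP; split.
  apply: le_trans s1; apply: le_trans (ler_wpM2r t0 p1).
  rewrite (_ : _ - _ = weight m * (rho * h) * (tl (n + m) b x - 3 * (Lam * h))); last by ring.
  rewrite -[leRHS]mulrA ler_wpM2l//.
  move: l1 t0 t1 Lh; rewrite -/tl -/Lam; nra.
apply: le_trans s2 _; apply: le_trans (ler_wpM2r t0' p2) _.
by rewrite mulrAC mulrC.
Qed.

Let sum_next_tail x : \sum_(i < K) next_tail i x =
  b%:R * tl n b.-1 x + n%:R * tl n.-1 b x.
Proof.
rewrite -(big_mkord xpredT (next_tail ^~ x)) (big_cat_nat (n := b))//=; last exact: leq_addr.
congr (_ + _).
  rewrite (eq_big_nat _ _ (F2 := fun=> tl n b.-1 x)).
    by rewrite big_const_nat subn0 iter_addr_0 -[LHS]mulr_natl.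
  by move=> i /andP[_ ib]; rewrite /next_tail ib leqNgt ib subn0 subn1.
rewrite (eq_big_nat _ _ (F2 := fun=> tl n.-1 b x)).
  by rewrite big_const_nat addKn iter_addr_0 -[LHS]mulr_natl.
by move=> i /andP[bi _]; rewrite /next_tail bi ltnNge bi subn0 subn1.
Qed.

Let completions_bounds (x h : R) : 0 <= x -> 0 <= h -> 2 * (Lam * h) <= 1 ->
  h * (b%:R / K%:R * tl n b.-1 x + n%:R / K%:R * tl n.-1 b x) - 3 * (h * (Lam * h))
    <= fine (P (surviving (x + h) `&` completions h)) <=
  h * (b%:R / K%:R * tl n b.-1 x + n%:R / K%:R * tl n.-1 b x).
Proof.
move=> x0 h0 h1.
rewrite prob_completions; last exact: measurable_sojourn_longer.
have -> : h * (b%:R / K%:R * tl n b.-1 x + n%:R / K%:R * tl n.-1 b x) =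
    \sum_(i < K) h / K%:R * next_tail i x.
  by rewrite -mulr_sumr sum_next_tail; ring.
have -> : 3 * (h * (Lam * h)) = \sum_(i < K) h / K%:R * (3 * (Lam * h)).
  rewrite sumr_const card_ord -mulr_natl.
  by field; rewrite gt_eqF.
rewrite -sumrB; apply/andP; split; apply: ler_sum => i _.
  by rewrite -mulrBr; case/andP: (completion_term (ltn_ord i) x0 h0 h1).
by case/andP: (completion_term (ltn_ord i) x0 h0 h1).
Qed.

Let prob_completions_ge h : 0 <= h -> 2 * (Lam * h) <= 1 ->
  h * (1 - 2 * (Lam * h)) <= fine (P (completions h)).
Proof.
move=> h0 h1; rewrite -[completions h]setTI prob_completions//.
have -> : h * (1 - 2 * (Lam * h)) = \sum_(i < K) h / K%:R * (1 - 2 * (Lam * h)).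
  by rewrite sumr_const card_ord -mulr_natl; field; rewrite gt_eqF.
apply: ler_sum => i _; rewrite setTI.
by case/andP: (completion_prob (ltn_ord i) h0 h1).
Qed.

Let arrivals_bounds (x h : R) : 0 <= x -> 0 <= h -> 2 * (Lam * h) <= 1 ->
  rho * h * arrival_mean q A B S n b x - 3 * (rho * h * (Lam * h))
    <= fine (P (surviving (x + h) `&` arrivals h))
    <= rho * h * arrival_mean q A B S n b x.
Proof.
move=> x0 h0 h1.
have ms : measurable (surviving (x + h)) by exact: measurable_sojourn_longer.
have msm m : measurable (surviving (x + h) `&` arrival_ m h).
  by apply: measurableI => //; exact: measurable_arrival.
have w0 m : 0 <= weight m by exact: batch_weight_ge0.
have rh : 0 <= rho * h by rewrite mulr_ge0// ltW.
have Lh : 0 <= Lam * h by rewrite mulr_ge0// ltW.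
have wt0 m : 0 <= weight m * tl (n + m) b x by rewrite mulr_ge0// tail_ge0.
rewrite lerBlDr -!lee_fin EFinD -prob_EFin; last exact: measurableI.
rewrite prob_arrivals// EFinM -arrival_meanE//.
rewrite -nneseriesZl; last by move=> m _; rewrite lee_fin; exact: wt0.
have -> : (3 * (rho * h * (Lam * h)))%:E =
    (\sum_(m <oo) (3 * (rho * h * (Lam * h)))%:E * (weight m)%:E)%E.
  by rewrite nneseriesZl ?sum_batch_weight ?mule1// => m _; rewrite lee_fin.
rewrite -nneseriesD//; last first.
  move=> m _ _; rewrite -EFinM lee_fin; apply: mulr_ge0 => //.
  by apply: mulr_ge0 => //; exact: mulr_ge0.
apply/andP; split; apply: lee_nneseries => //.
- by move=> m _ _; rewrite -EFinM lee_fin; apply: mulr_ge0 => //; exact: wt0.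
- move=> m _; apply: le_trans (_ : ((fine (P (surviving (x + h) `&` arrival_ m h)))%:E +
     (3 * (rho * h * (Lam * h)))%:E * (weight m)%:E <= _)%E); last first.
    by apply: leeD => //; rewrite prob_EFin.
  rewrite -!EFinM -EFinD lee_fin -lerBlDr.
  by case/andP: (arrival_term m x0 h0 h1).
- move=> m _; apply: le_trans (_ : ((fine (P (surviving (x + h) `&` arrival_ m h)))%:E <= _)%E).
    by rewrite prob_EFin.
  by rewrite -!EFinM lee_fin; case/andP: (arrival_term m x0 h0 h1).
Qed.

Let prob_arrivals_ge h : 0 <= h -> 2 * (Lam * h) <= 1 ->
  rho * h * (1 - 2 * (Lam * h)) <= fine (P (arrivals h)).
Proof.
move=> h0 h1; have w0 m : 0 <= weight m by exact: batch_weight_ge0.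
rewrite -lee_fin -prob_EFin; last exact: measurable_arrivals.
rewrite -[arrivals h]setTI prob_arrivals//.
have -> : (rho * h * (1 - 2 * (Lam * h)))%:E =
    (\sum_(m <oo) (rho * h * (1 - 2 * (Lam * h)))%:E * (weight m)%:E)%E.
  by rewrite nneseriesZl ?sum_batch_weight ?mule1// => m _; rewrite lee_fin.
have c0 : 0 <= 1 - 2 * (Lam * h) by rewrite subr_ge0.
apply: lee_nneseries => m _; last first.
  rewrite setTI -EFinM; apply: le_trans (_ : ((fine (P (arrival_ m h)))%:E <= _)%E).
    rewrite lee_fin; case/andP: (arrival_prob m h0 h1) => + _.
    by apply: le_trans; rewrite le_eqVlt; apply/orP; left; apply/eqP; ring.
  by rewrite prob_EFin//; exact: measurable_arrival.
by move=> _; rewrite -EFinM lee_fin !mulr_ge0// ltW.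
Qed.

(** Put L = Lam h = h + rho h. From below, completions lose 3 h L and arrivals 3 rho h L, in all 3
    L^2. From above, the missing mass costs only 2 L^2, because the event probabilities are at least
    1 - L, h (1 - 2 L) and rho h (1 - 2 L). *)
Lemma one_step_estimate (x h : R) : 0 <= x -> 0 < h -> 2 * (Lam * h) <= 1 ->
  `|tl n b (x + h) - tl n b x - h * drift n b x| <= 3 * (Lam * h) ^+ 2.
Proof.
move=> x0 h0 h1; have h0' := ltW h0.
have ms : measurable (surviving (x + h)) by exact: measurable_sojourn_longer.
have mq : measurable (quiet_ h) by exact: measurable_quiet.
have /andP[] := prob_three_parts P ms mq (measurable_completions h)
  (measurable_arrivals h) (disjoint_qc h) (disjoint_qa h) (disjoint_ca h).
have -> : fine (P (surviving (x + h) `&` quiet_ h)) = fine (P (quiet_ h)) * tl n b x.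
  by rewrite setIC (quiet_surviving rho_gt0 q_law queue n b_gt0 x h0).
rewrite -[fine (P (surviving (x + h)))]/(tl n b (x + h)).
have := completions_bounds x0 h0' h1; have := arrivals_bounds x0 h0' h1.
have := prob_completions_ge h0' h1; have := prob_arrivals_ge h0' h1.
have : 1 - Lam * h <= fine (P (quiet_ h)).
  by apply: le_trans (quiet_ge queue n b_gt0 h0); exact: expR_ge1Dx.
have := tail_ge0 A B S n b x; have := tail_le1 A B S n b x.
rewrite -/tl /drift -/Lam (addnC n b) -/K.
have LE : Lam * h = h + rho * h by rewrite /Lam mulrDl mul1r.
have r0 : 0 <= rho * h by rewrite mulr_ge0// ltW.
move: (fine (P (quiet_ h))) (fine (P (completions h))) (fine (P (arrivals h)))
  (fine (P (surviving (x + h) `&` completions h)))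
  (fine (P (surviving (x + h) `&` arrivals h))) (arrival_mean _ _ _ _ _ _ _)
  (tl n b x) (tl n b (x + h)) (b%:R / K%:R * tl n b.-1 x) (n%:R / K%:R * tl n.-1 b x).
move=> pq pc pa sc sa M e e' tb tn e1 e0 hq ha hc /andP[ha1 ha2] /andP[hc1 hc2] lo up.
have Lh0 : 0 <= Lam * h by rewrite mulr_ge0// ltW.
have -> : h * (rho * M - Lam * e + tn + tb) = rho * h * M - Lam * h * e + h * (tb + tn).
  by ring.
move: LE lo up ha1 ha2 hc1 hc2 hq ha hc h1 Lh0 r0.
move: (rho * h * M) (h * (tb + tn)) => RM HT.
move: (Lam * h) => L; move: (rho * h) => r LE lo up ha1 ha2 hc1 hc2 hq ha hc h1 L0 r0.
rewrite ler_norml expr2; apply/andP; split; subst L; nra.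
Qed.

End estimate.

(** * From the expansion to the derivative *)

Lemma nneseries_real (R : realType) (u : nat -> R) k (l : R) :
  (forall m, 0 <= u m) -> (\sum_(k <= m <oo) (u m)%:E = l%:E)%E ->
  \big[+%R/0]_(k <= m <oo) u m = l.
Proof.
move=> u0 ul; apply: cvg_lim => //.
have H : (fun j => (\sum_(k <= m < j) u m)%:E) @ \oo --> l%:E.
  under eq_fun do rewrite -sumEFin.
  by rewrite -ul; apply: is_cvg_nneseries => m _ _; rewrite lee_fin.
exact: (fine_cvg H).
Qed.

Section derivative.
Context d (T : measurableType d) (R : realType) (P : probability T R).
Context (rho : R) (q : nat -> R) (A : nat -> {RV P >-> R})
  (B : nat -> {RV P >-> nat}) (S : nat -> {RV P >-> R}).
Hypothesis rho_gt0 : 0 < rho.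
Hypothesis q_law : batch_size_law q.
Hypothesis queue : batch_queue_primitives rho q A B S.
Let tl := tail A B S.
Let Lam := 1 + rho.

Let Lam_gt0 : 0 < Lam. Proof. by rewrite addr_gt0. Qed.

Lemma arrival_mean_series n b y :
  \big[+%R/0]_(1 <= m <oo) (q m * tl (n + m) b y) = arrival_mean q A B S n b y.
Proof.
have [q0 _] := q_law.
pose u m := if m is 0%N then 0 else q m * tl (n + m) b y.
have -> : \big[+%R/0]_(1 <= m <oo) (q m * tl (n + m) b y) =
    \big[+%R/0]_(1 <= m <oo) u m.
  by congr (limn _); apply/funext => k; apply: eq_big_nat => -[].
have u0 m : 0 <= u m by case: m => [|m] //=; rewrite mulr_ge0 ?q0// tail_ge0.
apply: nneseries_real => //.
rewrite -arrival_meanE// nneseries_recl.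
- rewrite mul0r add0e. apply: congr_lim; apply/funext => k.
  by apply: eq_big_nat => -[].
- move=> m _; rewrite lee_fin mulr_ge0 ?tail_ge0//.
  by case: m => [|m] //; exact: q0.
- by [].
Qed.

(** The arrival term contributes rho Lam, the diagonal term Lam^2, and each of the two completion
    terms at most Lam, as their coefficients are at most 1. *)
Lemma drift_lipschitz n b (x h : R) : (0 < b)%N -> 0 <= x -> 0 <= h ->
  `|drift rho q A B S n b (x + h) - drift rho q A B S n b x|
    <= (rho * Lam + Lam * Lam + 2 * Lam) * h.
Proof.
move=> b0 x0 h0.
have K0 : (0 : R) < (n + b)%:R by rewrite ltr0n addn_gt0 b0 orbT.
have n0 : (0 : R) <= n%:R / (n + b)%:R by rewrite divr_ge0.
have n1 : (n%:R / (n + b)%:R : R) <= 1.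
  by rewrite ler_pdivrMr// mul1r ler_nat leq_addr.
have b0' : (0 : R) <= b%:R / (n + b)%:R by rewrite divr_ge0.
have b1 : (b%:R / (n + b)%:R : R) <= 1.
  by rewrite ler_pdivrMr// mul1r ler_nat leq_addl.
have /andP[m1 m2] := arrival_mean_lipschitz rho_gt0 q_law queue n b x0 h0.
have /andP[t1 t2] := tail_lipschitz rho_gt0 q_law queue n b x0 h0.
have /andP[r1 r2] := tail_lipschitz rho_gt0 q_law queue n.-1 b x0 h0.
have /andP[s1 s2] := tail_lipschitz rho_gt0 q_law queue n b.-1 x0 h0.
rewrite /drift -/Lam; rewrite -/Lam in m1 m2 t1 t2 r1 r2 s1 s2.
have Lh : 0 <= Lam * h by rewrite mulr_ge0// ltW.
have D1 : `|rho * (arrival_mean q A B S n b (x + h) - arrival_mean q A B S n b x)|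
    <= rho * (Lam * h).
  rewrite normrM gtr0_norm// ler_wpM2l//; first exact: ltW.
  by rewrite ler_norml; lra.
have D2 : `|Lam * (tail A B S n b (x + h) - tail A B S n b x)| <= Lam * (Lam * h).
  rewrite normrM gtr0_norm// ler_wpM2l//; first exact: ltW.
  by rewrite ler_norml; lra.
have D (c t t' : R) : 0 <= c -> c <= 1 -> t - Lam * h <= t' -> t' <= t ->
    `|c * (t' - t)| <= Lam * h.
  move=> c0 c1 tt tt'; rewrite normrM ger0_norm//.
  apply: (@le_trans _ _ (1 * (Lam * h))); last by rewrite mul1r.
  by apply: ler_pM => //; rewrite ler_norml; lra.
have D3 := D _ _ _ n0 n1 r1 r2; have D4 := D _ _ _ b0' b1 s1 s2.
move: D1 D2 D3 D4; rewrite !ler_norml => /andP[? ?] /andP[? ?] /andP[? ?] /andP[? ?].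
by apply/andP; split; lra.
Qed.

(** The expansion goes forward in time. For y < x it is therefore taken at [y], and
    [drift_lipschitz] moves the drift from [y] to [x]; hence the sum of two constants. *)
Lemma tail_difference_quotient n b (x y : R) : (0 < b)%N -> 0 <= x -> 0 <= y ->
    y != x -> 2 * (Lam * `|y - x|) <= 1 ->
  `|drift rho q A B S n b x - (tl n b y - tl n b x) / (y - x)|
    <= (3 * Lam ^+ 2 + (rho * Lam + Lam * Lam + 2 * Lam)) * `|y - x|.
Proof.
set C := rho * Lam + Lam * Lam + 2 * Lam; move=> b0 x0 y0 yx small.
have C0 : 0 <= C by rewrite /C !addr_ge0// !mulr_ge0// ltW.
have quotient (z h : R) : 0 <= z -> 0 < h -> 2 * (Lam * h) <= 1 ->
    `|drift rho q A B S n b z - (tl n b (z + h) - tl n b z) / h|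
      <= 3 * Lam ^+ 2 * h.
  move=> z0 h0 h1.
  have hn0 : h != 0 by rewrite gt_eqF.
  rewrite (_ : _ - _ = - ((tl n b (z + h) - tl n b z -
    h * drift rho q A B S n b z) / h)); last first.
    by rewrite [in RHS]mulrBl (mulrAC h) mulfV// mul1r opprB.
  rewrite normrN normrM normfV (gtr0_norm h0) ler_pdivrMr//.
  rewrite (_ : 3 * Lam ^+ 2 * h * h = 3 * (Lam * h) ^+ 2); last by ring.
  exact: one_step_estimate.
have [xy|yx'|/eqP] := ltgtP x y; last by rewrite eq_sym (negbTE yx).
  have h0 : 0 < y - x by rewrite subr_gt0.
  rewrite (gtr0_norm h0) in small *.
  have := quotient x (y - x) x0 h0 small; rewrite (addrC x) subrK => H.
  by apply: le_trans H _; rewrite ler_wpM2r ?lerDl// ltW.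
have h0 : 0 < x - y by rewrite subr_gt0.
rewrite distrC (gtr0_norm h0) in small *.
have := quotient y (x - y) y0 h0 small; rewrite (addrC y) subrK => H1.
have := drift_lipschitz n b0 y0 (ltW h0); rewrite (addrC y) subrK -/C => H2.
rewrite (_ : (tl n b y - tl n b x) / (y - x) = (tl n b x - tl n b y) / (x - y)).
  apply: le_trans (ler_distD (drift rho q A B S n b y) _ _) _.
  by rewrite [leRHS]mulrDl [leRHS]addrC; exact: lerD.
by rewrite -(opprB x y) -(opprB (tl n b x)) invrN mulrNN.
Qed.

Lemma tail_has_derivative n b (x : R) : (0 < b)%N -> 0 <= x ->
  has_derivative_nonneg (tl n b) x (drift rho q A B S n b x).
Proof.
move=> b0 x0; apply/cvgrPdist_le => e e0.
set C := 3 * Lam ^+ 2 + (rho * Lam + Lam * Lam + 2 * Lam).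
have C0 : 0 < C.
  rewrite ltr_wpDl//; first by rewrite mulr_ge0// sqr_ge0.
  by rewrite !addr_gt0// !mulr_gt0.
rewrite near_withinE near_withinE; near=> y => yx.
rewrite /= in_itv/= andbT => y0.
(* Two radii: e / C brings the bound below e, and 1 / (2 Lam) is the range of validity of the
   one-step estimate. *)
have yxC : `|y - x| <= e / C.
  by near: y; apply: (@cvgr_distC_le _ _ _ (nbhs x) _ id x) => //; exact: divr_gt0.
have yxL : `|y - x| <= (2 * Lam)^-1.
  by near: y; apply: (@cvgr_distC_le _ _ _ (nbhs x) _ id x) => //;
    rewrite invr_gt0 mulr_gt0.
apply: le_trans (tail_difference_quotient n b0 x0 y0 yx _) _.
  by rewrite mulrA -ler_pdivlMl ?mulr1// mulr_gt0.
by rewrite -/C mulrC -ler_pdivlMr.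
Unshelve. all: end_near.
Qed.

End derivative.

Theorem proposition2p1 (d : measure_display) (T : measurableType d)
    (R : realType) (P : probability T R) (rho : R) (q : nat -> R)
    (A : nat -> {RV P >-> R}) (B : nat -> {RV P >-> nat})
    (S : nat -> {RV P >-> R})
    (rho_gt0 : 0 < rho)
    (q_law : batch_size_law q)
    (q_mean_fin : (mean_batch_size q < +oo)%E)
    (q_load : (rho%:E * mean_batch_size q < 1)%E)
    (queue : batch_queue_primitives rho q A B S) :
  let E := sojourn_tail A B S in
  forall (n b : nat) (x : R), (1 <= b)%N -> 0 <= x ->
    has_derivative_nonneg (E n%:Z b%:Z) x
      (rho * (\big[+%R/0]_(1 <= m <oo) (q m * E (n%:Z + m%:Z) b%:Z x))
       - (1 + rho) * E n%:Z b%:Z x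
       + n%:R / (n + b)%:R * E (n%:Z - 1) b%:Z x
       + b%:R / (n + b)%:R * E n%:Z (b%:Z - 1) x).
Proof.
move=> E n b x b0 x0.
have EE n' b' y : (0 < b')%N -> E n'%:Z b'%:Z y = tail A B S n' b' y.
  by case: b'.
have -> : E n%:Z b%:Z = tail A B S n b by apply/funext => y; exact: EE.
have -> : n%:R / (n + b)%:R * E (n%:Z - 1) b%:Z x =
    n%:R / (n + b)%:R * tail A B S n.-1 b x.
  case: n => [|n]; first by rewrite !mul0r.
  by rewrite -EE//; congr (_ * E _ _ _); lia.
have -> : E n%:Z (b%:Z - 1) x = tail A B S n b.-1 x.
  (* At b = 1 the convention gives 0, which is the tail of the empty batch since [x] is
     nonnegative. *)
  case: b b0 => [//|[|b]] _; first by rewrite tail_empty_batch.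
  by rewrite -EE//; congr (E _ _ _); lia.
have -> : \big[+%R/0]_(1 <= m <oo) (q m * E (n%:Z + m%:Z) b%:Z x) =
    arrival_mean q A B S n b x.
  rewrite -(arrival_mean_series A B S q_law); congr (limn _).
  by apply/funext => k; apply: eq_bigr => m _; rewrite -PoszD EE.
exact: (tail_has_derivative rho_gt0 q_law queue).
Qed.
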